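(* Let $\epsilon>0$ be a small enough constant and let $\delta>0$ be such that $\delta\le \epsilon^4$. Let $G=(V,E)$ be an $(n,d,\lambda)$-graph with $\frac{\lambda}{d}\le \delta$. Let $p=\frac{1+\epsilon}{d}$. Form $G_p$ by retaining every edge of $G$ independently with probability $p$. Let $L_1$ be the giant (largest) connected component of $G_p$. Then there exists an absolute constant $c>0$ such that with high probability, for any $S\subseteq L_1$ such that $\frac{\epsilon^2 n}{50}\le |S|\le \frac{12\epsilon n}{11}$, we have $$\big|\partial_{G_p}(S)\big|\ge\frac{c\,\epsilon^2|S|}{\ln\left(\frac{1}{\epsilon}\right)}.$$
   Context: An $(n,d,\lambda)$-graph is a $d$-regular graph on $n$ vertices whose adjacency matrix has eigenvalues $d=\lambda_1\ge\lambda_2\ge\dots\ge\lambda_n$ with $\lambda=\max\{|\lambda_2|,|\lambda_n|\}$. For a graph $H$ and $S\subseteq V(H)$, $\partial_H(S)$ is the set of edges of $H$ with exactly one endpoint in $S$. ''With high probability'' means with probability tending to $1$ as $n\to\infty$, where $\epsilon,\delta$ are fixed and $G=G_n$ ranges over any sequence of $(n,d,\lambda)$-graphs satisfying the hypotheses ($d,\lambda$ may depend on $n$). ''$\epsilon$ small enough constant'' means that there is an absolute constant $\epsilon_0>0$ such that the statement holds for every fixed $0<\epsilon\le\epsilon_0$; ''absolute constant'' means independent of $\epsilon,\delta,n,d,\lambda,G$. The component $L_1$ is identified with its vertex set. $\ln$ is the natural logarithm. *)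

(* Defs.v *)
(* Mathematical Components + MathComp-Analysis *)
From HB Require Import structures.
From mathcomp Require Import all_boot all_order all_algebra.
From mathcomp Require Import all_classical all_reals all_analysis.

Set Implicit Arguments.
Unset Strict Implicit.
Unset Printing Implicit Defensive.

Import Order.TTheory GRing.Theory Num.Theory.
Import numFieldNormedType.Exports.

Local Open Scope ring_scope.

Record sgraph (n : nat) := SGraph {
  adj : rel 'I_n;
  adj_sym : symmetric adj;
  adj_irrefl : irreflexive adj
}.

Definition regular n (G : sgraph n) (d : nat) : Prop :=
  forall x : 'I_n, #|[set y | adj G x y]| = d.

Definition adjmx (R : realType) n (G : sgraph n) : 'M[R]_n :=
  \matrix_(x, y) (adj G x y)%:R.

(* The eigenvalues are listed with multiplicity in nonincreasing order, so
   lambda_j is s`_(j-1).  The bound 1 < n makes lambda_2 meaningful. *)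
Definition ndl_graph (R : realType) n (G : sgraph n) (d : nat) (lambda : R)
    : Prop :=
  [/\ (1 < n)%N, regular G d &
    exists s : n.-tuple R,
      [/\ sorted >=%R s,
          char_poly (adjmx R G) = \prod_(x <- s) ('X - x%:P),
          s`_0 = d%:R &
          lambda = Num.max `|s`_1| `|s`_n.-1| ]].

(* An edge is the unordered pair of its two (distinct) endpoints. *)
Definition edges n (G : sgraph n) : {set {set 'I_n}} :=
  [set [set z.1; z.2] | z : 'I_n * 'I_n & adj G z.1 z.2].

(* Spanning subgraphs of G are represented by their edge sets F \subset edges G;
   the next three definitions concern the graph ('I_n, F). *)
Definition component n (F : {set {set 'I_n}}) (x : 'I_n) : {set 'I_n} :=
  [set y | connect [rel u v | [set u; v] \in F] x y].

(* Ties are allowed: every component of maximum order qualifies. *)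
Definition largest_component n (F : {set {set 'I_n}}) (L : {set 'I_n}) : Prop :=
  (exists x, L = component F x) /\ forall y, (#|component F y| <= #|L|)%N.

Definition edge_boundary n (F : {set {set 'I_n}}) (S : {set 'I_n})
    : {set {set 'I_n}} :=
  [set e in F | #|e :&: S| == 1%N].

(* Probability that the edge set of G_p satisfies A, when the edges of G are
   retained independently with probability p (meaningful for 0 <= p <= 1). *)
Definition percolation_pr (R : realType) n (G : sgraph n) (p : R)
    (A : {set {set 'I_n}} -> Prop) : R :=
  \sum_(F in powerset (edges G) | `[< A F >])
    p ^+ #|F| * (1 - p) ^+ #|edges G :\: F|.

(* Main.v *)
Require Import Defs.
From HB Require Import structures.
From mathcomp Require Import all_boot all_order all_algebra.
From mathcomp Require Import all_classical all_reals all_analysis.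
From mathcomp Require Import complex fintype finset zify ring lra.

Set Implicit Arguments.
Unset Strict Implicit.
Unset Printing Implicit Defensive.

Import Order.TTheory GRing.Theory Num.Theory.
Import numFieldNormedType.Exports.

Local Open Scope ring_scope.

(** The proof is a first-moment bound over sparse cuts. Let [S] be a set of [s]
    vertices inside one component of the random edge set [F], and suppose that
    its edge boundary [D] has at most [K] elements, where [K] is about
    [c eps^2 s / ln (1/eps)]. Every vertex of [S] is joined inside [S] to an end
    of an edge of [D] or to one fixed vertex of [S]. So in [A = F \ D] the set
    [S] is exactly what can be reached from some set [J] of at most [K + 1]
    vertices ([boundary_seeds]). Weighing the elements of [J] and of [D] by
    [z = eps^5] and summing over all [J] and [D] costs a factor
    [z^-(2K+1) (1+z)^n (1 + z p/(1-p))^(ds)] ([low_cut_prob]), which is at most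
    [eps^-5 exp (3 eps^2 s / 400)]: since [z^-(2K) = exp (10 K ln (1/eps))], the
    logarithm in the theorem is what makes this cost affordable
    ([union_factor_le]). It remains to show, for each fixed [J], that exactly
    [s] vertices are reached from [J] with probability at most
    [2 exp (- eps^2 s / 100)] ([reach_prob]).

    To this end explore from [J] in breadth-first order, asking about one edge
    of [G] at a time. Whatever the past, a question is answered positively with
    probability [p = (1 + eps) / d], so the exponential of
    [a (discovered vertices) - p (a + 2 a^2) (questions)] is a supermartingale
    for every [a <= 1/2] ([potential_explored]). An exploration that ends with
    the set [S] of size [s] had at most [s] positive answers. On the other
    hand it asked about all the edges that meet [S], except for some edges whose
    two ends were waiting in the queue together. By expander mixing there are
    at least [d s - d s^2 / (2n)] edges meeting [S], up to a small error, and
    [s <= 12 eps n / 11] makes the subtracted term at most [(6/11) eps d s]. If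
    the queue never exceeds about [s / 50], the edges inside the queue amount to
    about [eps d s / 20] ([closed_queried]). Hence the expected number of
    positive answers is at least [(1 + 0.38 eps) s], and falling short of it
    has probability at most [exp (- eps^2 s / 100)] ([exhausted_exponent]). A
    longer queue means a success rate exceeding [p] by a constant factor over
    at most [d s] questions; this has probability [exp (- const s)]
    ([stuck_exponent]).

    Summing over [s >= eps^2 n / 50] bounds the probability of a sparse cut by
    [O (n exp (- eps^4 n / 20000))] for fixed [eps] ([expands_prob]). *)

(** * Quadratic forms of symmetric matrices *)

Section HermitianForm.
Variables (C : numClosedFieldType) (n : nat) (M : 'M[C]_n).
Hypothesis Mherm : M \is hermsymmx.
Local Open Scope sesquilinear_scope.
Let P := spectralmx M.
Let D := spectral_diag M.

Let MP : M = P^t* *m diag_mx D *m P.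
Proof.
rewrite -invmx_unitary ?spectral_unitarymx //.
exact/orthomx_spectralP/hermitian_normalmx.
Qed.

Let PtP : P^t* *m P = 1%:M.
Proof. by rewrite -invmx_unitary ?spectral_unitarymx // mulVmx ?spectral_unit. Qed.

Let PPt : P *m P^t* = 1%:M.
Proof. exact/unitarymxP/spectral_unitarymx. Qed.

Lemma char_poly_spectral : char_poly M = \prod_i ('X - (D 0 i)%:P).
Proof.
have -> : char_poly M = char_poly (diag_mx D).
  rewrite /char_poly /char_poly_mx MP !map_mxM /=.
  set A := map_mx _ (P^t*); set B := map_mx _ P.
  have AB : A *m B = 1%:M by rewrite -map_mxM PtP map_mx1.
  have -> : 'X%:M - A *m map_mx polyC (diag_mx D) *m B
            = A *m ('X%:M - map_mx polyC (diag_mx D)) *m B.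
    by rewrite mulmxBr mulmxBl [A *m _%:M]scalar_mxC -[_%:M *m A *m B]mulmxA AB mulmx1.
  rewrite !det_mulmx mulrAC -det_mulmx AB det1 mul1r //.
rewrite char_poly_trig ?diag_mx_is_trig //.
by apply: eq_bigr => i _; rewrite mxE eqxx.
Qed.

Lemma dotmx_spectral (u v : 'rV[C]_n) :
  (u *m v^t*) 0 0 = \sum_i (u *m P^t*) 0 i * ((v *m P^t*) 0 i)^*.
Proof.
rewrite -[u in LHS]mulmx1 -PtP mulmxA -mulmxA.
rewrite mxE; apply: eq_bigr => i _; congr (_ * _).
rewrite -[P in LHS]trmxCK -map_mxM -trmx_mul !mxE //.
Qed.

Lemma quadratic_form_spectral (v : 'rV[C]_n) :
  (v *m M *m v^t*) 0 0 = \sum_i D 0 i * `|(v *m P^t*) 0 i| ^+ 2.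
Proof.
rewrite dotmx_spectral; apply: eq_bigr => i _.
have -> : v *m M *m P^t* = v *m P^t* *m diag_mx D.
  by rewrite {1}MP !mulmxA -mulmxA PPt mulmx1.
by rewrite mul_mx_diag mxE normCK mulrAC mulrA [D 0 i * _]mulrC mulrAC.
Qed.

Lemma eigenvector_spectral (u : 'rV[C]_n) (a : C) i :
  u *m M = a *: u -> D 0 i != a -> (u *m P^t*) 0 i = 0.
Proof.
move=> uM Dia; have : (u *m P^t* *m diag_mx D) 0 i = a * (u *m P^t*) 0 i.
  have -> : u *m P^t* *m diag_mx D = a *: (u *m P^t*).
    by rewrite scalemxAl -uM {1}MP !mulmxA -(mulmxA _ P) PPt mulmx1.
  by rewrite mxE.
rewrite mul_mx_diag mxE mulrC => /eqP; rewrite -subr_eq0 -mulrBl mulf_eq0.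
by rewrite subr_eq0 (negPf Dia) => /eqP.
Qed.

End HermitianForm.

Section RealQuadraticForm.
Local Open Scope sesquilinear_scope.

(** The bound is read off an orthonormal eigenbasis. The all-ones vector is an
    eigenvector for the simple eigenvalue [d], so the corresponding coordinate
    of [v] is its component along the all-ones vector and carries the first
    term; all the other eigenvalues are at most [lam]. The embedding [toC] is
    there because the spectral theorem is stated over an algebraically closed
    field. *)
Lemma quadratic_form_le_embedded (R : realFieldType) (C : numClosedFieldType)
    (toC : {rmorphism R -> C}) n (M : 'M[R]_n) (s : seq R) (d lam : R)
    (v : 'rV[R]_n) :
  (forall x y, (toC x <= toC y) = (x <= y)) -> (forall x, (toC x)^* = toC x) ->
  M^T = M -> char_poly M = \prod_(x <- s) ('X - x%:P) ->
  (const_mx 1 : 'rV_n) *m M = d *: const_mx 1 ->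
  count_mem d s = 1%N -> (forall x, x \in s -> x != d -> x <= lam) -> 0 <= lam ->
  (v *m M *m v^T) 0 0 <=
    d * (\sum_i v 0 i) ^+ 2 / n%:R + lam * \sum_i v 0 i ^+ 2.
Proof.
move=> toC_le toC_conj Msym Mchar M1 cnt lamP lam0.
have toC_sqr x : `|toC x| ^+ 2 = toC (x ^+ 2).
  by rewrite normCK toC_conj expr2 rmorphM.
set Mc := map_mx toC M.
have Mherm : Mc \is hermsymmx.
  apply/is_hermitianmxP; rewrite expr0 scale1r; apply/matrixP => i j.
  by rewrite !mxE toC_conj -{1}Msym mxE.
set P := spectralmx Mc; set D := spectral_diag Mc.
have Ds : perm_eq [seq D 0 i | i <- index_enum 'I_n] (map toC s).
  apply: prod_XsubC_eq; rewrite !big_map -char_poly_spectral //.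
  by rewrite -map_char_poly Mchar map_prod_XsubC.
have cntD : #|[set i | D 0 i == toC d]| = 1%N.
  have : count (pred1 (toC d)) [seq D 0 i | i <- index_enum 'I_n] = 1%N.
    rewrite (permP Ds) count_map -[RHS]cnt; apply: eq_count => x /=.
    by rewrite (inj_eq (fmorph_inj toC)).
  by rewrite -sum1_count big_map sum1dep_card.
have /cards1P [i0 Di0] : #|[set i | D 0 i == toC d]| == 1%N by rewrite cntD.
have Dd i : (D 0 i == toC d) = (i == i0).
  by move/setP: Di0 => /(_ i); rewrite !inE.
set vc := map_mx toC v; pose w i := (vc *m P^t*) 0 i.
pose u : 'rV[C]_n := const_mx 1.
have uM : u *m Mc = toC d *: u.
  have -> : u = map_mx toC (const_mx 1).
    by apply/matrixP => i j; rewrite !mxE rmorph1.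
  by rewrite -map_mxM M1 map_mxZ.
(* The all-ones vector has a single nonzero coordinate in the eigenbasis. *)
pose a i := (u *m P^t*) 0 i.
have a0 i : i != i0 -> a i = 0.
  by move=> ii0; apply: (eigenvector_spectral Mherm uM); rewrite -/D Dd.
have dotu (x : 'rV[R]_n) : toC (\sum_i x 0 i) = (map_mx toC x *m P^t*) 0 i0 * (a i0)^*.
  have := dotmx_spectral Mc (map_mx toC x) u; rewrite -/P (bigD1 i0) //= [X in _ + X]big1 ?addr0; last first.
    by move=> i /a0; rewrite -/(a i) => ai0; rewrite [X in _ * X^*]ai0 (conjC0 C) mulr0.
  move=> <-; rewrite mxE rmorph_sum; apply: eq_bigr => i _.
  by rewrite !mxE conjC1 mulr1.
have n0 : (0 < n)%N by case: (n) i0 {Di0 Dd a0 dotu} => [[]|].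
have an : `|a i0| ^+ 2 = n%:R.
  have := dotu (const_mx 1); rewrite (eq_bigr (fun=> 1)) => [|i _]; last by rewrite mxE.
  have -> : map_mx toC (const_mx 1) = u by apply/matrixP => i j; rewrite !mxE rmorph1.
  by rewrite -/(a i0) -normCK sumr_const card_ord rmorph_nat => <-.
have wi0 : `|w i0| ^+ 2 = toC ((\sum_i v 0 i) ^+ 2 / n%:R).
  have := congr1 (fun x => `|x| ^+ 2) (dotu v); rewrite toC_sqr normrM exprMn norm_conjC an.
  rewrite rmorphM => ->; rewrite fmorphV rmorph_nat mulfK // pnatr_eq0.
  by rewrite -lt0n.
have normv : toC (\sum_i v 0 i ^+ 2) = \sum_i `|w i| ^+ 2.
  rewrite (eq_bigr (fun i => w i * (w i)^*)); last by move=> i _; rewrite normCK.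
  rewrite -dotmx_spectral // mxE rmorph_sum; apply: eq_bigr => i _.
  by rewrite !mxE toC_conj expr2 rmorphM.
rewrite -toC_le.
have -> : toC ((v *m M *m v^T) 0 0) = \sum_i D 0 i * `|w i| ^+ 2.
  rewrite -quadratic_form_spectral //.
  have -> : vc^t* = map_mx toC v^T.
    by apply/matrixP => i j; rewrite !mxE toC_conj.
  by rewrite /vc /Mc -!map_mxM [RHS]mxE.
rewrite rmorphD -mulrA [toC (d * _)]rmorphM [toC (lam * _)]rmorphM /= -wi0 normv (bigD1 i0) //= mulr_sumr.
have /eqP -> : D 0 i0 == toC d by rewrite Dd.
rewrite lerD2l [leRHS](bigD1 i0) //= ler_wpDl //.
  by rewrite mulr_ge0 ?exprn_ge0 //; have := toC_le 0 lam; rewrite rmorph0 lam0.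
apply: ler_sum => i ii0; rewrite ler_wpM2r ?exprn_ge0 //.
have : D 0 i \in map toC s.
  by rewrite -(perm_mem Ds); apply/mapP; exists i; rewrite ?mem_index_enum.
case/mapP => x xs Dx; rewrite Dx toC_le lamP //.
by apply: contra_neq ii0 => xd; apply/eqP; rewrite -Dd Dx xd.
Qed.

Lemma quadratic_form_le (R : rcfType) n (M : 'M[R]_n) (s : seq R) (d lam : R)
    (v : 'rV[R]_n) :
  M^T = M -> char_poly M = \prod_(x <- s) ('X - x%:P) ->
  (const_mx 1 : 'rV_n) *m M = d *: const_mx 1 ->
  count_mem d s = 1%N -> (forall x, x \in s -> x != d -> x <= lam) -> 0 <= lam ->
  (v *m M *m v^T) 0 0 <=
    d * (\sum_i v 0 i) ^+ 2 / n%:R + lam * \sum_i v 0 i ^+ 2.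
Proof.
apply: (@quadratic_form_le_embedded _ _ (real_complex R)) => x *.
  exact: lecR.
exact: conjc_real.
Qed.

End RealQuadraticForm.

(** * Edges of an expander inside a vertex set *)

(** Every edge inside [S] is counted twice. *)
Definition inner_degree n (G : sgraph n) (S : {set 'I_n}) : nat :=
  \sum_(x in S) #|[set y in S | adj G x y]|.

(** Among the eigenvalues after the first, the second is the largest, so the
    maximum that defines [lambda] bounds them all. *)
Lemma sorted_norm_le (R : realType) (s : seq R) m x :
  sorted >=%R (m :: s) -> x \in s ->
  x <= Num.max `|(m :: s)`_1| `|(m :: s)`_(size s)|.
Proof.
case: s => // a s /= /andP[_ /order_path_min/allP]; rewrite inE => H.
have {}H : forall y, y \in s -> y <= a by apply: H => u v w /=; move=> *; apply: le_trans; eauto.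
by case/orP => [/eqP->|/H xa]; rewrite le_max (le_trans _ (ler_norm a)).
Qed.

Lemma spectral_radius_ge0 (R : realType) n (G : sgraph n) d (lambda : R) :
  ndl_graph G d lambda -> 0 <= lambda.
Proof. by case=> _ _ [s [_ _ _ ->]]; rewrite le_max normr_ge0. Qed.

(** The upper half of expander mixing for a single set: the quadratic form of
    the adjacency matrix evaluated at the indicator vector of [S]. *)
Lemma inner_degree_le (R : realType) n (G : sgraph n) d (lambda : R)
    (S : {set 'I_n}) :
  ndl_graph G d lambda -> lambda < d%:R ->
  (inner_degree G S)%:R <= d%:R * #|S|%:R ^+ 2 / n%:R + lambda * #|S|%:R.
Proof.
move=> Gndl; have lam0 := spectral_radius_ge0 Gndl.
case: Gndl => n1 Greg [s [s_sorted s_char s0 lamE]] lamd.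
pose v : 'rV[R]_n := \row_i (i \in S)%:R.
have vS : \sum_i v 0 i = #|S|%:R.
  rewrite -sum1_card natr_sum [RHS]big_mkcond; apply: eq_bigr => i _.
  by rewrite mxE; case: ifP.
have vS2 : \sum_i v 0 i ^+ 2 = #|S|%:R.
  by rewrite -vS; apply: eq_bigr => i _; rewrite mxE -natrX; case: (i \in S).
have szs : size s = n by rewrite size_tuple.
have -> : (inner_degree G S)%:R = (v *m adjmx R G *m v^T) 0 0.
  rewrite -mulmxA mxE natr_sum big_mkcond; apply: eq_bigr => x _.
  rewrite !mxE; case: ifP => xS; last by rewrite mul0r.
  rewrite mul1r -sum1_card natr_sum big_mkcond; apply: eq_bigr => y _.
  by rewrite !inE !mxE; case: (y \in S); case: (adj G x y); rewrite ?mulr0 ?mulr1.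
have [a [t st]] : exists a t, s = a :: t :> seq R.
  by case: (val s) szs n1 => [<-//|a t _ _]; exists a, t.
have ad : a = d%:R by rewrite -s0 st.
have tP x : x \in t -> x <= lambda.
  have -> : lambda = Num.max `|(a :: t)`_1| `|(a :: t)`_(size t)|.
    by rewrite lamE -st -[in n.-1]szs st.
  by apply: sorted_norm_le; rewrite -st.
rewrite -{1}vS -[X in lambda * X]vS2; apply: (quadratic_form_le (s := s)) => //.
- by apply/matrixP => i j; rewrite !mxE adj_sym.
- apply/matrixP => i j; rewrite !mxE mulr1 -(Greg j) -sum1_card natr_sum [RHS]big_mkcond.
  by apply: eq_bigr => k _; rewrite !mxE mul1r inE adj_sym; case: ifP.
- rewrite st /= ad eqxx; congr (_.+1); apply/count_memPn/negP => /tP.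
  by rewrite leNgt lamd.
- by move=> x; rewrite st inE ad => /orP[->//|/tP].
Qed.

(** Mixing applied to the two ends of one edge forces the degree to be large,
    and therefore the retention probability to be small. *)
Lemma degree_lower_bound (R : realType) n (G : sgraph n) d (lambda : R) :
  ndl_graph G d lambda -> (0 < d)%N -> lambda < d%:R ->
  1 <= d%:R * (2 / n%:R) + lambda.
Proof.
move=> Gndl d0 lamd; have [n1 Greg _] := Gndl.
pose x : 'I_n := Ordinal (ltnW n1).
have /card_gt0P[y] : (0 < #|[set y | adj G x y]|)%N by rewrite Greg.
rewrite inE => xy.
have xNy : x != y by apply: contraTneq xy => <-; rewrite adj_irrefl.
have := inner_degree_le [set x; y] Gndl lamd.
have : (2 <= inner_degree G [set x; y])%N.
  rewrite /inner_degree big_setU1 ?big_set1 /= ?inE // -[2%N]/(1 + 1)%N.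
  by apply: leq_add; apply/card_gt0P; [exists y|exists x];
    rewrite !inE eqxx ?orbT //= adj_sym.
rewrite -(ler_nat R) cards2 xNy /= => h1 h2.
have := le_trans h1 h2; have : (n%:R : R)^-1 >= 0 by rewrite invr_ge0.
nra.
Qed.

(** * Random subsets and adaptive queries *)

Section SubsetSum.
Variables (R : realFieldType) (T : finType).
Implicit Types (a b : R) (E A D : {set T}) (f : {set T} -> R).

(** For [b = 1 - a] this is the expectation of [f] at a random subset of [E]
    that keeps every element independently with probability [a]. General
    weights also cover the binomial sums of the union bound. *)
Definition subset_sum a b E f : R :=
  \sum_(A in powerset E) a ^+ #|A| * b ^+ #|E :\: A| * f A.

(** Conditioning on whether [e] is kept. *)
Lemma subset_sum_split a b E f e : e \in E ->
  subset_sum a b E f = a * subset_sum a b (E :\ e) (fun A => f (e |: A))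
                       + b * subset_sum a b (E :\ e) f.
Proof.
move=> eE; rewrite /subset_sum (bigID (fun A => e \in A)) /= !mulr_sumr.
congr (_ + _).
  rewrite (reindex_onto (fun A => e |: A) (fun A => A :\ e)) /=; last first.
    by move=> A /andP[_ eA]; rewrite setD1K.
  apply: eq_big => [A|A].
    rewrite !powersetE setU11 andbT subUset sub1set eE /= subsetD1.
    case: (boolP (e \in A)) => eA; last by rewrite setU1K ?eqxx.
    rewrite andbF; apply/negbTE; rewrite negb_and orbC; apply/orP; left.
    by apply: contraTneq eA => <-; rewrite !inE eqxx.
  move=> /andP[/andP[AE _] /eqP Ae].
  have eA : e \notin A by rewrite -Ae !inE eqxx.
  by rewrite cardsU1 eA add1n exprS setDDl !mulrA.
apply: eq_big => [A|A /andP[_ eA]].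
  by rewrite !powersetE subsetD1.
rewrite !mulrA; congr (_ * _); rewrite [b * _]mulrC -mulrA -exprS.
congr (_ * _ ^+ _); rewrite setDDl [[set e] :|: A]setUC -setDDl.
by rewrite [LHS](cardsD1 e (E :\: A)) !inE eA eE.
Qed.

Lemma subset_sum1 a b E : subset_sum a b E (fun=> 1) = (a + b) ^+ #|E|.
Proof.
have [m] := ubnP #|E|; elim: m E => // m IH E.
have [->|/set0Pn[e eE]] := eqVneq E set0.
  by rewrite /subset_sum powerset0 big_set1 setD0 cards0 !mulr1.
rewrite (cardsD1 e) eE add1n => Em.
by rewrite (subset_sum_split _ _ _ eE) !IH // exprS mulrDl.
Qed.

Lemma subset_sumZ a b E f c :
  subset_sum a b E (fun A => f A * c) = subset_sum a b E f * c.
Proof. by rewrite mulr_suml; apply: eq_bigr => A _; rewrite mulrA. Qed.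

Lemma subset_sumD a b E f g :
  subset_sum a b E (fun A => f A + g A) = subset_sum a b E f + subset_sum a b E g.
Proof. by rewrite -big_split; apply: eq_bigr => A _; rewrite /= mulrDr. Qed.

Lemma subset_sum_exchange a b E (I : finType) (P : pred I) (f : I -> {set T} -> R) :
  subset_sum a b E (fun A => \sum_(i | P i) f i A)
  = \sum_(i | P i) subset_sum a b E (f i).
Proof. by rewrite exchange_big; apply: eq_bigr => A _; rewrite /= mulr_sumr. Qed.

Lemma ler_subset_sum a b E f g : 0 <= a -> 0 <= b ->
  (forall A, A \subset E -> f A <= g A) ->
  subset_sum a b E f <= subset_sum a b E g.
Proof.
move=> a0 b0 fg; apply: ler_sum => A; rewrite powersetE => AE.
by rewrite ler_wpM2l ?fg // mulr_ge0 ?exprn_ge0.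
Qed.

(** Passing from the pair [(F, D)] to the pair [(F :\: D, D)] turns the elements
    of [D] from kept to discarded, which accounts for one factor [a / b] each. *)
Lemma subset_sum_erase a b E (f : {set T} -> {set T} -> R) : b != 0 ->
  subset_sum a b E (fun F => \sum_(D in powerset F) f (F :\: D) D)
  = subset_sum a b E (fun A =>
      \sum_(D in powerset (E :\: A)) (a / b) ^+ #|D| * f A D).
Proof.
move=> b0; rewrite /subset_sum.
under eq_bigr do rewrite mulr_sumr.
under [RHS]eq_bigr do rewrite mulr_sumr.
rewrite !pair_big_dep /=.
rewrite (reindex_onto (fun z => (z.1 :|: z.2, z.2)) (fun z => (z.1 :\: z.2, z.2))) /=;
  last first.
  case=> F D /=; rewrite !powersetE => /andP[_ DF].
  by rewrite setUC setDE setUIr setUCr setIT; congr pair; apply/setUidPr.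
have disj (A D : {set T}) : ((A :|: D) :\: D == A) = (D \subset ~: A).
  by rewrite setDUl setDv setU0 -disjoints_subset disjoint_sym; apply/eqP/idP => /setDidPl.
apply: eq_big => [[A D]|[A D]] /=.
  rewrite !powersetE xpair_eqE eqxx andbT disj subsetUr andbT subUset setDE subsetI.
  by rewrite andbA.
rewrite !powersetE xpair_eqE eqxx andbT => /andP[/andP[AE _] AD].
rewrite (eqP AD) !mulrA; congr (_ * _).
move: AD AE; rewrite disj subUset => AD /andP[AE DE].
have DEA : D \subset E :\: A by rewrite setDE subsetI DE.
rewrite -setDDl.
have -> : #|A :|: D| = (#|A| + #|D|)%N.
  rewrite cardsU; suff -> : A :&: D = set0 by rewrite cards0 subn0.
  by apply/eqP; rewrite setIC setI_eq0 disjoints_subset.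
have -> : b ^+ #|E :\: A| = b ^+ #|E :\: A :\: D| * b ^+ #|D|.
  by rewrite -exprD [#|_ :\: D|]cardsDS // subnK // subset_leq_card.
by rewrite exprD expr_div_n; field; rewrite expf_neq0.
Qed.

End SubsetSum.

Lemma percolation_prE (R : realType) n (G : sgraph n) (p : R) P :
  percolation_pr G p P = subset_sum p (1 - p) (edges G) (fun F => (`[< P F >])%:R).
Proof.
rewrite /percolation_pr big_mkcondr; apply: eq_bigr => F _.
by case: ifP; rewrite ?mulr1 ?mulr0.
Qed.

Section AdaptiveQueries.
Variables (R : realFieldType) (T : finType) (St X : Type) (E : {set T}).
Variables (queried : St -> {set T}) (edge_of : X -> T).
Variables (next : St -> option X) (upd : St -> X -> bool -> St).
Hypothesis next_fresh : forall st x, next st = Some x -> edge_of x \in E :\: queried st.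
Hypothesis queried_upd : forall st x c, queried (upd st x c) = edge_of x |: queried st.

Fixpoint run m st (A : {set T}) : St :=
  if m is m'.+1 then
    if next st is Some x then run m' (upd st x (edge_of x \in A)) A else st
  else st.

(** The status of an element that has already been queried has no further
    influence on the run: this is the independence of the answers. *)
Lemma run_queried m st A e : e \in queried st -> run m st (e |: A) = run m st A.
Proof.
elim: m st => //= m IH st eQ; case stx: (next st) => [x|//].
have := next_fresh stx; rewrite inE => /andP[xQ _].
have -> : (edge_of x \in e |: A) = (edge_of x \in A).
  by rewrite in_setU1; case: eqP xQ => // ->; rewrite eQ.
by rewrite IH // queried_upd in_setU1 eQ orbT.
Qed.

(** Optional stopping: the answer to a fresh query is independent of the past,
    so a function of the state that does not increase on average in one step
    does not increase on average along the run. *)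
Lemma subset_sum_run_le (a b : R) (g : St -> R) m st :
  0 <= a -> 0 <= b -> a + b = 1 ->
  (forall st x, next st = Some x ->
     a * g (upd st x true) + b * g (upd st x false) <= g st) ->
  subset_sum a b (E :\: queried st) (fun A => g (run m st A)) <= g st.
Proof.
move=> a0 b0 ab gP.
have const st' (F : {set T}) : subset_sum a b F (fun=> g st') = g st'.
  rewrite -[RHS]mul1r -(expr1n _ #|F|) -ab -subset_sum1 -subset_sumZ.
  by apply: eq_bigr => A _; rewrite mul1r.
elim: m st => [|m IH] st /=; first by rewrite const.
case stx: (next st) => [x|]; last by rewrite const.
apply: le_trans (gP _ _ stx).
have xQ := next_fresh stx; rewrite (subset_sum_split _ _ _ xQ).
rewrite -/(queried _) setDDl setUC -(queried_upd _ _ true).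
apply: lerD; rewrite ler_wpM2l //; apply: le_trans (IH _).
  apply: ler_subset_sum => // A _.
  by rewrite setU11 run_queried // queried_upd setU11.
rewrite (queried_upd _ _ true) (queried_upd _ _ false).
apply: ler_subset_sum => // A; rewrite -setDDl => /subsetP AE.
suff /negPf-> : edge_of x \notin A by [].
by apply/negP => /AE; rewrite !inE eqxx andbF.
Qed.

Lemma run_exhausted m st A : (#|E :\: queried st| <= m)%N -> next (run m st A) = None.
Proof.
elim: m st => [|m IH] st /=.
  case stx: (next st) => [x|//]; have := next_fresh stx.
  by rewrite leqn0 cards_eq0 => xQ /eqP E0; rewrite E0 inE in xQ.
case stx: (next st) => [x|//]; rewrite (cardsD1 (edge_of x)) (next_fresh stx) => Em.
by apply: IH; rewrite queried_upd setUC -setDDl.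
Qed.

Lemma run_invariant (I : St -> Prop) m st (A : {set T}) :
  (forall st x, I st -> next st = Some x -> I (upd st x (edge_of x \in A))) ->
  I st -> I (run m st A).
Proof.
move=> IP; elim: m st => //= m IH st Ist.
by case stx: (next st) => [x|//]; apply/IH/IP.
Qed.

End AdaptiveQueries.

(** * Breadth-first exploration *)

Definition reach n (A : {set {set 'I_n}}) (J : {set 'I_n}) : {set 'I_n} :=
  [set y | [exists x in J, connect [rel u v | [set u; v] \in A] x y]].

Lemma reach_step n (A : {set {set 'I_n}}) (J : {set 'I_n}) u v :
  u \in reach A J -> [set u; v] \in A -> v \in reach A J.
Proof.
rewrite !inE => /existsP[x /andP[xJ xu]] uv; apply/existsP; exists x.
by rewrite xJ (connect_trans xu) // connect1.
Qed.

Lemma mem_reach n (A : {set {set 'I_n}}) (J : {set 'I_n}) u :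
  u \in J -> u \in reach A J.
Proof. by move=> uJ; rewrite inE; apply/existsP; exists u; rewrite uJ connect0. Qed.

Lemma reach_min n (A : {set {set 'I_n}}) (J D : {set 'I_n}) :
  J \subset D ->
  (forall u v, u \in D -> [set u; v] \in A -> v \in D) -> reach A J \subset D.
Proof.
move=> JD closed; apply/subsetP => y; rewrite inE => /existsP[x /andP[/(subsetP JD) xD]].
case/connectP => p; elim: p x xD => [|w p IH] x xD /=; first by move=> _ ->.
by case/andP => xw; apply: IH; apply: closed xw.
Qed.

Section Edges.
Variables (n : nat) (G : sgraph n).
Local Notation V := 'I_n.
Implicit Types (S : {set V}) (D : seq V).

Definition query_edge (z : V * V) : {set V} := [set z.1; z.2].

Lemma query_edge_eq x y x' y' : query_edge (x, y) = query_edge (x', y') ->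
  (x = x' /\ y = y') \/ (x = y' /\ y = x').
Proof.
rewrite /query_edge /= => E.
have : x' \in [set x; y] by rewrite E !inE eqxx.
have : y' \in [set x; y] by rewrite E !inE eqxx orbT.
have : x \in [set x'; y'] by rewrite -E !inE eqxx.
have : y \in [set x'; y'] by rewrite -E !inE eqxx orbT.
rewrite !inE => /orP[]/eqP yE /orP[]/eqP xE; rewrite yE xE; auto.
  by move=> /orP[]/eqP ->; auto.
by move=> _ /orP[]/eqP ->; auto.
Qed.

Lemma mem_edges u v : ([set u; v] \in edges G) = adj G u v.
Proof.
apply/imsetP/idP => [[[a b]]|uv]; last by exists (u, v); rewrite ?inE.
rewrite inE /= => ab /(@query_edge_eq u v a b)[[-> ->]//|[-> ->]].
by rewrite adj_sym.
Qed.

Lemma card_darts S d : regular G d ->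
  #|[set z : V * V | (z.1 \in S) && adj G z.1 z.2]| = (d * #|S|)%N.
Proof.
move=> Greg; rewrite mulnC -sum_nat_const.
rewrite (eq_bigr (fun v => \sum_(y in [set y | adj G v y]) 1)%N) => [|v _];
  last by rewrite sum1_card Greg.
by rewrite pair_big_dep -sum1_card; apply: eq_bigl => -[x y]; rewrite !inE.
Qed.

Definition incident S : {set {set V}} := [set e in edges G | e :&: S != finset.set0].

Lemma card_incident S d : regular G d -> (#|incident S| <= d * #|S|)%N.
Proof.
move=> Greg; rewrite -(card_darts S Greg).
apply: leq_trans (leq_imset_card query_edge _); apply: subset_leq_card.
apply/subsetP => e; rewrite inE => /andP[/imsetP[[x y]]]; rewrite inE /= => xy ->.
case/set0Pn => v; rewrite !inE => /andP[/orP[]/eqP->] vS; apply/imsetP.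
  by exists (x, y); rewrite ?inE ?vS.
by exists (y, x); rewrite ?inE /= ?vS 1?adj_sym // /query_edge setUC.
Qed.

Lemma card_index_interval D a b :
  (#|[set x in D | (a <= index x D < a + b)%N]| <= b)%N.
Proof.
rewrite cardE -(size_map (fun x => index x D)) -[leqRHS](size_iota a).
apply: uniq_leq_size.
  rewrite map_inj_in_uniq ?enum_uniq // => x y.
  rewrite !mem_enum !inE => /andP[xD _] /andP[yD _]; exact: (index_inj x xD yD).
by move=> k /mapP[x]; rewrite mem_enum inE => /andP[_ xw] ->; rewrite mem_iota.
Qed.

End Edges.

Section Exploration.
Variables (n : nat) (G : sgraph n) (B : nat).
Local Notation V := 'I_n.
(** The vertices discovered so far, in the order of their discovery, together
    with the edges queried so far. *)
Definition state : Type := (seq V * {set {set V}})%type.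
Implicit Types (st : state) (z : V * V) (A : {set {set V}}) (J : {set V}).

Definition fresh st v u : bool :=
  [&& adj G v u, u \notin st.1 & [set v; u] \notin st.2].

Definition exhausted_before st v : bool :=
  [forall w in st.1, (index w st.1 < index v st.1)%N ==> [forall u, ~~ fresh st w u]].

Definition front st z : bool :=
  [&& z.1 \in st.1, fresh st z.1 z.2 & exhausted_before st z.1].

(** Breadth-first order: the query is made from the earliest vertex that still
    has something to ask. The exploration gives up once [B] or more vertices
    have been discovered after that vertex, that is, when the queue is long. *)
Definition next_query st : option (V * V) :=
  [pick z | front st z && (size st.1 <= index z.1 st.1 + B)%N].

Definition answer st z (c : bool) : state :=
  (if c then rcons st.1 z.2 else st.1, [set z.1; z.2] |: st.2).

Lemma next_query_fresh st z : next_query st = Some z -> query_edge z \in edges G :\: st.2.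
Proof.
rewrite /next_query; case: pickP => // x /andP[/and3P[_ /and3P[zG _ zQ] _] _] [<-].
by rewrite inE zQ /query_edge mem_edges.
Qed.

Lemma queried_answer st z c : (answer st z c).2 = query_edge z |: st.2.
Proof. by []. Qed.

Lemma exhausted_beforeP st v :
  reflect (forall w, w \in st.1 -> (index w st.1 < index v st.1)%N ->
             forall u, ~~ fresh st w u) (exhausted_before st v).
Proof.
apply: (iffP forall_inP) => [H w wD wv u|H w wD].
  by have /implyP/(_ wv)/forallP := H w wD.
by apply/implyP => wv; apply/forallP => u; apply: H.
Qed.

(** The last two clauses carry the analysis. Every query was made from a vertex
    all of whose predecessors are exhausted, so the number of queries is
    controlled by the position reached in the list. An edge between two
    discovered vertices escapes the queries only if their positions are at most
    [B] apart: when the later end was discovered, the earlier one either was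
    exhausted, and had asked about this edge, or still belonged to the short
    queue. *)
Definition consistent A J st : Prop :=
  [/\ uniq st.1, {subset J <= st.1}, {subset st.1 <= reach A J},
      forall e, e \in st.2 -> e \in A -> {subset e <= st.1} &
      [/\ st.2 \subset edges G,
      forall e, e \in st.2 ->
        exists2 w, (w \in st.1) && (w \in e) & exhausted_before st w &
      forall a b, a \in st.1 -> b \in st.1 -> adj G a b ->
        (index a st.1 < index b st.1)%N ->
        [set a; b] \in st.2 \/ (index b st.1 <= index a st.1 + B)%N]].

Lemma consistent_init A J : (#|J| <= B)%N -> consistent A J (enum J, finset.set0).
Proof.
move=> JB; split => /=; first exact: enum_uniq.
- by move=> x; rewrite mem_enum.
- by move=> x; rewrite mem_enum; apply: mem_reach.
- by move=> e; rewrite inE.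
split => [|e|a b aJ bJ _ _]; rewrite ?sub0set ?inE //.
by right; rewrite (leq_trans (ltnW _) (leq_addl _ _)) // (leq_trans _ JB) // cardE index_mem.
Qed.

Lemma consistent_answer A J st z : consistent A J st -> next_query st = Some z ->
  consistent A J (answer st z (query_edge z \in A)).
Proof.
case: st => D Q [/= Duniq JD DA QA [QG Qw Qband]] zP.
have := next_query_fresh zP; rewrite inE => /andP[/= zQ zE].
have {zP} : front (D, Q) z && (size D <= index z.1 D + B)%N.
  by move: zP; rewrite /next_query; case: pickP => // x xP [<-].
case/andP=> /and3P[/= z1D /and3P[/= zG z2D _] zex] zB.
set c := query_edge z \in A; pose D' := if c then rcons D z.2 else D.
have DD' : {subset D <= D'}.
  by rewrite /D' => x xD; case: (c) => //; rewrite mem_rcons inE xD orbT.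
have D'E x : x \in D' -> x \in D \/ c /\ x = z.2.
  by rewrite /D'; case: (c) => [|]; [rewrite mem_rcons inE => /orP[/eqP|]|]; auto.
have idxD x : x \in D -> index x D' = index x D.
  by rewrite /D' => xD; case: (c) => //; rewrite -cats1 index_cat xD.
have idxz : c -> index z.2 D' = size D.
  by rewrite /D' => ->; rewrite -cats1 index_cat (negPf z2D) /= eqxx addn0.
have fresh' w u : fresh (D', query_edge z |: Q) w u -> fresh (D, Q) w u.
  rewrite /fresh /= => /and3P[-> uD' wuQ]; rewrite (contra (@DD' u)) //=.
  by apply: contra wuQ; rewrite in_setU1 orbC => ->.
have ex' w : w \in D -> exhausted_before (D, Q) w ->
    exhausted_before (D', query_edge z |: Q) w.
  move=> wD /exhausted_beforeP wex; apply/exhausted_beforeP => /= w' w'D'.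
  rewrite (idxD w) // => w'w u; apply: contraNN (@fresh' w' u) _.
  have w'D : w' \in D.
    case: (D'E _ w'D') => // -[cT w'z]; move: w'w; rewrite w'z idxz //.
    by rewrite ltnNge ltnW // index_mem.
  by apply: wex => //=; rewrite -(idxD w').
rewrite /answer -/c -/(query_edge z) -/D'; split => /=.
- by rewrite /D'; case: (c) => //; rewrite rcons_uniq z2D.
- by move=> x /JD /DD'.
- move=> x /D'E [/DA//|[zA ->]]; apply: (reach_step (u := z.1)) => //; exact: DA.
- move=> e; rewrite in_setU1 => /orP[/eqP-> zA|eQ eA] x.
    rewrite !inE => /orP[/eqP->|/eqP->]; first exact: DD'.
    by rewrite /D' /c zA mem_rcons mem_head.
  by move=> /(QA _ eQ eA) /DD'.
split.
- by rewrite subUset sub1set zE.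
- move=> e; rewrite in_setU1 => /orP[/eqP->|/Qw[w /andP[wD we] wex]].
    by exists z.1; [rewrite DD' // !inE eqxx | exact: ex'].
  by exists w; [rewrite DD' | exact: ex'].
move=> a b aD' bD' ab; rewrite in_setU1.
case: (D'E _ aD') => [aD|[cT ->]]; last first.
  rewrite idxz //; case: (D'E _ bD') => [bD|[_ ->]]; last by rewrite idxz // ltnn.
  by rewrite idxD // ltnNge ltnW // index_mem.
rewrite idxD //; case: (D'E _ bD') => [bD|[cT bz]].
  by rewrite idxD // => /(Qband _ _ aD bD ab) [->|]; [left; rewrite orbT | right].
(* [b] is the vertex just discovered: it was outside the list when the vertices
   before [z.1] finished their queries, and the queue from [z.1] on is short. *)
rewrite bz idxz // => _; case: (ltnP (index a D) (index z.1 D)) => az.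
  left; have /exhausted_beforeP/(_ a aD az b) := zex.
  by rewrite /fresh /= ab bz z2D /= negbK => ->; rewrite orbT.
by right; rewrite (leq_trans zB) // leq_add2r.
Qed.

Definition stuck st : Prop :=
  exists w, [/\ w \in st.1, exhausted_before st w, (exists u, fresh st w u) &
                (index w st.1 + B < size st.1)%N].

Lemma next_query_None st : next_query st = None ->
  stuck st \/ forall v u, v \in st.1 -> ~~ fresh st v u.
Proof.
move=> stN; have [/existsP[v0 v0P]|noF] := boolP [exists v, (v \in st.1) && [exists u, fresh st v u]].
  left; pose P v := (v \in st.1) && [exists u, fresh st v u].
  case: (@arg_minnP _ v0 P (fun v => index v st.1) v0P) => v /andP[vD /existsP[u vu]] vmin.
  have vex : exhausted_before st v.
    apply/exhausted_beforeP => w wD wv u'; apply/negP => wu'.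
    have /vmin : P w by rewrite /P wD; apply/existsP; exists u'.
    by rewrite leqNgt wv.
  exists v; split => //; first by exists u.
  rewrite ltnNge; apply/negP => sz; move: stN; rewrite /next_query.
  by case: pickP => // /(_ (v, u)); rewrite /front /= vD vu vex sz.
right=> v u vD; apply: contra noF => vu; apply/existsP; exists v.
by rewrite vD; apply/existsP; exists u.
Qed.

(** A vertex that made a query has only exhausted predecessors, whereas [w] is
    not exhausted; hence all queries were made from positions up to that of
    [w]. *)
Lemma stuck_queried A J d st w u : regular G d -> consistent A J st ->
  w \in st.1 -> fresh st w u -> (#|st.2| <= d * (index w st.1).+1)%N.
Proof.
case: st => D Q /= Greg [/= Duniq _ _ _ [QG Qw _]] wD wu.
pose W := [set v in D | (0 <= index v D < 0 + (index w D).+1)%N].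
have QW : Q \subset incident G W.
  apply/subsetP => e eQ; have [v /andP[/= vD ve] vex] := Qw _ eQ.
  rewrite inE (subsetP QG) //=; apply/set0Pn; exists v.
  rewrite !inE ve vD /= add0n ltnS leqNgt; apply/negP => wv.
  by have /exhausted_beforeP/(_ w wD wv u) := vex; rewrite wu.
apply: leq_trans (subset_leq_card QW) (leq_trans (card_incident _ Greg) _).
by rewrite leq_mul2l card_index_interval orbT.
Qed.

(** An open edge leaving the list would have been queried, and a positive answer
    puts its end on the list. *)
Lemma closed_reach A J st : consistent A J st -> A \subset edges G ->
  (forall v u, v \in st.1 -> ~~ fresh st v u) -> reach A J =i st.1.
Proof.
case: st => D Q /= [/= Duniq JD DA QA _] AG noF x.
apply/idP/idP; last exact: DA.
suff /subsetP/(_ x) H : reach A J \subset [set y in D] by move=> /H; rewrite inE.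
apply: reach_min => [|u v]; first by apply/subsetP => y /JD; rewrite inE.
rewrite !inE => uD uvA; apply: contraT => vD.
have uvG : adj G u v by rewrite -mem_edges (subsetP AG).
have := noF u v uD; rewrite /fresh /= uvG vD /= negbK => uvQ.
by have := QA _ uvQ uvA v; rewrite !inE eqxx orbT (negPf vD) => /(_ isT).
Qed.

End Exploration.

(** * Queries made by a complete exploration *)

Section Count.
Variables (n : nat) (G : sgraph n) (B : nat).
Local Notation V := 'I_n.

Lemma inner_degreeE (S : {set V}) :
  inner_degree G S = #|[set z : V * V | [&& z.1 \in S, z.2 \in S & adj G z.1 z.2]]|.
Proof.
rewrite /inner_degree -sum1_card; under eq_bigr do rewrite -sum1_card.
by rewrite pair_big_dep; apply: eq_bigl => -[x y]; rewrite !inE.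
Qed.

Definition pairs_before (D : seq V) (S : {set V}) : {set V * V} :=
  [set z | [&& z.1 \in S, z.2 \in S, adj G z.1 z.2 & (index z.1 D < index z.2 D)%N]].

Lemma inner_degree_double (D : seq V) (S : {set V}) :
  {subset S <= D} -> inner_degree G S = (2 * #|pairs_before D S|)%N.
Proof.
move=> SD; pose swap (z : V * V) := (z.2, z.1).
have swapI : injective swap by move=> [x y] [x' y'] [-> ->].
rewrite inner_degreeE mul2n -addnn -[X in (_ + X)%N](card_imset _ swapI).
have -> : [set z : V * V | [&& z.1 \in S, z.2 \in S & adj G z.1 z.2]] =
  pairs_before D S :|: swap @: pairs_before D S.
  apply/setP => -[x y]; rewrite in_setU.
  have -> : ((x, y) \in swap @: pairs_before D S) = ((y, x) \in pairs_before D S).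
    by rewrite -[(x, y)]/(swap (y, x)) mem_imset.
  rewrite !inE /=; case xS: (x \in S); case yS: (y \in S) => //=.
  rewrite [adj G y x]adj_sym -andb_orr; case xy: (adj G x y) => //=.
  rewrite -neq_ltn; apply/esym/negP => /eqP idxE.
  have xEy : x = y by apply: (index_inj x (SD _ xS) (SD _ yS)).
  by rewrite xEy adj_irrefl in xy.
rewrite cardsU; suff -> : pairs_before D S :&: swap @: pairs_before D S = finset.set0.
  by rewrite cards0 subn0.
apply/setP => -[x y]; rewrite in_set0 in_setI.
rewrite -[(x, y) in X in _ && X]/(swap (y, x)) mem_imset // !inE /=.
by apply/negP => /andP[/and4P[_ _ _ xy] /and4P[_ _ _ yx]]; lia.
Qed.

(** Consecutive blocks overlap in half of their length, so any two vertices
    whose positions differ by at most [B] share a block. *)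
Definition block (D : seq V) (l : nat) : {set V} :=
  [set x in D | (l * B <= index x D < l.+2 * B)%N].

Lemma card_block D l : (#|block D l| <= 2 * B)%N.
Proof. by rewrite /block -addn2 mulnDl card_index_interval. Qed.

(** All the edges that meet [D] were queried, except for some whose ends are at
    most [B] positions apart, and those lie inside the blocks. Everything is
    doubled because [inner_degree] counts each edge twice. *)
Lemma closed_queried A J (D : seq V) Q d r :
  regular G d -> consistent G B A J (D, Q) -> (0 < B)%N -> (size D <= r * B)%N ->
  (forall v u, v \in D -> ~~ fresh G (D, Q) v u) ->
  (2 * (d * size D) <=
     2 * #|Q| + inner_degree G [set x in D] + \sum_(l < r) inner_degree G (block D l))%N.
Proof.
move=> Greg [/= Duniq _ _ _ [_ _ Dband]] B0 Dr noF.
pose S := [set x in D].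
have SD : {subset S <= D} by move=> x; rewrite inE.
have cardS : #|S| = size D by rewrite cardsE; apply/card_uniqP.
pose Pout := [set z : V * V | [&& z.1 \in D, z.2 \notin D & adj G z.1 z.2]].
pose Pfar := [set z in pairs_before D S | (index z.1 D + B < index z.2 D)%N].
pose Pband := [set z in pairs_before D S | (index z.2 D <= index z.1 D + B)%N].
have outE : (d * size D)%N = (#|Pout| + inner_degree G S)%N.
  rewrite -cardS -(card_darts S Greg).
  rewrite inner_degreeE -(cardsID [set z | z.2 \in D]) addnC; congr (_ + _)%N.
    by apply: eq_card => -[x y]; rewrite !inE /=; case: (x \in D); case: (y \in D) => //=; rewrite ?andbF.
  by apply: eq_card => -[x y]; rewrite !inE /=; case: (x \in D); case: (y \in D) => //=; rewrite ?andbF ?andbT.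
have befE : (#|pairs_before D S| <= #|Pfar| + #|Pband|)%N.
  rewrite -(cardsID [set z : V * V | (index z.1 D + B < index z.2 D)%N]).
  apply: leq_add; apply: subset_leq_card; apply/subsetP => z; rewrite !inE.
    by [].
  by rewrite -leqNgt andbC.
have QE : (#|Pout| + #|Pfar| <= #|Q|)%N.
  have <- : #|Pout :|: Pfar| = (#|Pout| + #|Pfar|)%N.
    rewrite cardsU; suff -> : Pout :&: Pfar = finset.set0 by rewrite cards0 subn0.
    apply/setP => -[x y]; rewrite !inE /=; case: (y \in D) => //=; rewrite ?andbF //.
  rewrite -(card_in_imset (f := @query_edge n)).
    apply: subset_leq_card; apply/subsetP => _ /imsetP[[x y] + ->].
    rewrite /query_edge !inE /= => /orP[/and3P[xD yD xy]|/andP[/and4P[xD yD xy lt] xyB]].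
      by have := noF x y xD; rewrite /fresh /= xy yD /= negbK.
    by case: (Dband _ _ xD yD xy lt) => // xyB'; move: xyB; rewrite ltnNge xyB'.
  move=> [x y] [x' y'] zP zP' /query_edge_eq /= [[-> ->]//|[xy' yx']].
  move: zP zP'; rewrite xy' yx' !inE /=.
  case/orP => [/and3P[a1 a2 a3]|/andP[/and4P[a1 a2 a3 a4] a5]];
  case/orP => [/and3P[b1 b2 b3]|/andP[/and4P[b1 b2 b3 b4] b5]];
    do ?by [rewrite a1 in b2|rewrite b1 in a2|rewrite b2 in a2]; lia.
have bandE : (2 * #|Pband| <= \sum_(l < r) inner_degree G (block D l))%N.
  have blockD l : {subset block D l <= D} by move=> x; rewrite inE => /andP[].
  under eq_bigr do rewrite (inner_degree_double (@blockD _)).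
  rewrite -big_distrr /= leq_mul2l /=.
  suff sub : Pband \subset \bigcup_(l < r) pairs_before D (block D l).
    apply: leq_trans (subset_leq_card sub) _.
    elim/big_rec2: _ => [|l m U _ Um]; first by rewrite cards0.
    by rewrite (leq_trans (leq_card_setU _ _)) // leq_add2l.
  apply/subsetP => -[x y]; rewrite !inE /= => /andP[/and4P[xD yD xy lt] xyB].
  have lr : (index x D %/ B < r)%N.
    by rewrite ltn_divLR // (leq_trans _ Dr) // index_mem.
  apply/bigcupP; exists (Ordinal lr) => //=; rewrite !inE /= xD yD xy lt /= andbT.
  have := divn_eq (index x D) B; have := ltn_pmod (index x D) B0.
  rewrite !mulSn; move: (_ %% _)%N (_ %/ _ * B)%N lt xyB => e q.
  move: (index x D) (index y D) => ix iy l1 l2 l3 l4.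
  clear - l1 l2 l3 l4; lia.
have := inner_degree_double SD; rewrite outE -/S.
move: befE QE bandE; move: #|_| #|_| #|_| #|_| #|_| (inner_degree G S) (\sum_(l < r) _)%N.
clear; lia.
Qed.
End Count.

(** * Large deviations of the exploration *)

Section Prob.
Variable R : realType.
Implicit Types (p a eps : R).

Lemma expR_le_quadratic a : a <= 1 / 2 -> expR a <= 1 + a + 2 * a ^+ 2.
Proof.
move=> a2; have : 1 - a <= expR (- a) by exact: expR_ge1Dx.
rewrite expRN => h; have a1 : 0 < 1 - a by lra.
have : expR a <= (1 - a)^-1 by rewrite -[leLHS]invrK lef_pV2 ?posrE ?invr_gt0 ?expR_gt0.
move=> /le_trans; apply; rewrite -div1r ler_pdivrMr //; nra.
Qed.

Lemma bernoulli_mgf_le p a : 0 <= p -> a <= 1 / 2 ->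
  p * expR a + (1 - p) <= expR (p * (a + 2 * a ^+ 2)).
Proof.
move=> p0 a2; apply: le_trans (expR_ge1Dx _).
have := expR_le_quadratic a2; nra.
Qed.

Section Exploring.
Variables (n : nat) (G : sgraph n) (B : nat).
Local Notation V := 'I_n.

(** The exponential supermartingale of a Chernoff bound: [p * (a + 2 * a ^+ 2)]
    dominates the logarithm of the moment generating function of one answer. *)
Definition potential p a (st : state n) : R :=
  expR (a * (size st.1)%:R - p * (a + 2 * a ^+ 2) * #|st.2|%:R).

Lemma potential_step p a st z : 0 <= p -> p <= 1 -> a <= 1 / 2 ->
  next_query G B st = Some z ->
  p * potential p a (answer st z true) + (1 - p) * potential p a (answer st z false)
    <= potential p a st.
Proof.
move=> p0 p1 a2 /next_query_fresh; rewrite inE => /andP[zQ _].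
rewrite /potential /= size_rcons cardsU1 -/(query_edge z) zQ add1n.
set b := p * (a + _); set k := (size _); set q := #|_|.
have -> : a * k.+1%:R - b * q.+1%:R = a + (a * k%:R - b * q%:R) - b.
  by rewrite -!natr1; ring.
have -> : a * k%:R - b * q.+1%:R = (a * k%:R - b * q%:R) - b.
  by rewrite -!natr1; ring.
move: (a * _ - _) => x; rewrite !expRD expRN; set g := expR x.
have := bernoulli_mgf_le p0 a2; rewrite -/b => h.
have -> : p * (expR a * g / expR b) + (1 - p) * (g / expR b)
  = g * ((p * expR a + (1 - p)) / expR b) by ring.
by rewrite ler_piMr ?expR_ge0 // ler_pdivrMr ?expR_gt0 // mul1r.
Qed.

(** No edge is queried twice, so [#|edges G|] steps complete the exploration. *)
Definition explored A (J : {set V}) : state n :=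
  run (@query_edge n) (next_query G B) (@answer n) #|edges G| (enum J, finset.set0) A.

Lemma potential_explored p a J : 0 <= p -> p <= 1 -> a <= 1 / 2 ->
  subset_sum p (1 - p) (edges G) (fun A => potential p a (explored A J))
    <= expR (a * #|J|%:R).
Proof.
move=> p0 p1 a2; have p1' : 0 <= 1 - p by rewrite subr_ge0.
have := @subset_sum_run_le R _ _ _ (edges G) (fun st => st.2) (@query_edge n)
  (next_query G B) (@answer n) (@next_query_fresh _ _ _) (@queried_answer _) p (1 - p)
  (potential p a) #|edges G| (enum J, finset.set0) p0 p1' (subrKC _ _)
  (fun st z => @potential_step p a st z p0 p1 a2).
rewrite /= setD0 => /le_trans; apply.
by rewrite /potential /= cards0 mulr0 subr0 -cardE.
Qed.

(** The first alternative is a queue that became too long behind position [c];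
    the second is an exploration that has nothing left to ask. *)
Lemma explored_cases (A : {set {set V}}) (J : {set V}) s d r :
  regular G d -> A \subset edges G -> (#|J| <= B)%N -> (0 < B)%N -> (s <= r * B)%N ->
  #|reach A J| = s ->
  let st := explored A J in
  (exists c, [/\ (c + B < size st.1)%N, (c < s)%N & (#|st.2| <= d * c.+1)%N])
  \/ size st.1 = s /\
     exists (S : {set V}) (I : 'I_r -> {set V}),
       [/\ #|S| = s, forall l, (#|I l| <= 2 * B)%N &
       (2 * (d * s) <= 2 * #|st.2| + inner_degree G S + \sum_(l < r) inner_degree G (I l))%N].
Proof.
move=> Greg AE JB B0 sB Rs st.
have stc : consistent G B A J st.
  by apply: run_invariant => *; [exact: consistent_answer | exact: consistent_init].
have stN : next_query G B st = None.
  apply: (run_exhausted (@next_query_fresh _ _ _) (@queried_answer _)).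
  by rewrite setD0.
have Ds : (size st.1 <= s)%N.
  rewrite -Rs; case: stc => /card_uniqP <- _ DR _ _.
  by apply/subset_leq_card/subsetP.
case: (next_query_None stN) => [[w [wD wex [u wu] wB]]|noF].
  left; exists (index w st.1); split => //.
    by rewrite (leq_trans _ Ds) // index_mem.
  exact: (stuck_queried Greg stc wD wu).
right; have D_reach := closed_reach stc AE noF.
have Dsz : size st.1 = s.
  by rewrite -Rs (eq_card D_reach); case: stc => /card_uniqP.
split=> //; exists [set x in st.1], (fun l => block B st.1 l); split.
- by rewrite cardsE -Dsz; case: stc => /card_uniqP.
- by move=> l; apply: card_block.
rewrite -{1}Dsz; move: stc noF; rewrite -{}Dsz in sB *; case: (st) sB => D Q /= sB stc noF.
exact: closed_queried stc _ _ _.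
Qed.

End Exploring.

(** Here [k] vertices are discovered by [q] queries from the first [c + 1]
    vertices of the list, although these queries have only about [c + 1]
    expected successes, up to a factor [1 + eps]. The surplus [B], at least
    [s / 50], is a constant fraction of [s], so a constant parameter [1 / 200]
    of the potential already yields an exponent linear in [s]. *)
Lemma stuck_exponent (p eps : R) (d c B s k q : nat) :
  p * d%:R = 1 + eps -> 0 <= p -> 0 < eps -> eps <= 1 / 1000 ->
  (s <= 50 * B)%N -> (c + B < k)%N -> (c < s)%N -> (q <= d * c.+1)%N ->
  s%:R / 500 / 50 <= 1 / 200 * k%:R - p * (1 / 200 + 2 * (1 / 200) ^+ 2) * q%:R :> R.
Proof.
move=> pd p0 e0 e1 sB cB cs qd.
have {}sB : s%:R <= 50 * B%:R :> R by rewrite -natrM ler_nat.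
have {}cB : c.+1%:R + B%:R <= k%:R :> R by rewrite -natrD ler_nat addSn.
have {}cs : c.+1%:R <= s%:R :> R by rewrite ler_nat.
have {}qd : p * q%:R <= (1 + eps) * c.+1%:R.
  by rewrite -pd -mulrA -natrM ler_wpM2l // ler_nat.
have c0 : 0 <= c.+1%:R :> R by [].
have : eps * c.+1%:R <= 1 / 1000 * c.+1%:R by rewrite ler_wpM2r.
have -> : p * (1 / 200 + 2 * (1 / 200) ^+ 2) * q%:R
  = (1 / 200 + 2 * (1 / 200) ^+ 2) * (p * q%:R) by ring.
move: (p * q%:R) (c.+1%:R : R) qd cB cs c0 => y x; rewrite mulrDl; move: (eps * x) => ex.
lra.
Qed.

(** The numbers [N] and [S] stand for [inner_degree] of the explored set and its
    sum over the blocks, and [b] for the half-length of a block. The expected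
    number of successes [p * Q] is at least [(1 + eps) s - p N / 2 - p S / 2].
    The main loss [p N / 2] is about [s^2 / (2n)], at most [(6/11) eps s], and
    the blocks cost about [eps s / 20], which leaves [(1 + 38/100 eps) s]. With
    the parameter [- h] of the potential the gain is about
    [h (38/100 eps - 2 h) s], nearly maximal at [h = eps / 10]. *)
Lemma exhausted_exponent (p eps lambda N S D Q s b n : R) :
  p * D = 1 + eps -> 0 <= p -> 0 < eps -> eps <= 1 / 1000 ->
  0 < n -> 0 <= b -> 45 * b <= s -> 11 * s <= 12 * eps * n -> 0 <= lambda ->
  lambda <= eps ^+ 2 * D ->
  N <= D * s ^+ 2 / n + lambda * s ->
  S <= 50 * (D * (2 * b) ^+ 2 / n + lambda * (2 * b)) ->
  2 * (D * s) <= 2 * Q + N + S ->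
  eps ^+ 2 * s / 100 <=
    (- (eps / 10)) * s - p * (- (eps / 10) + 2 * (- (eps / 10)) ^+ 2) * Q.
Proof.
move=> pD p0 e0 e1 n0 b0 bs sn lam0 lamD NE SE QE.
have s0 : 0 <= s by lra.
have t11 : 11 * (s / n) <= 12 * eps.
  by rewrite mulrA ler_pdivrMr.
have t0 : 0 <= s / n by rewrite divr_ge0 // ltW.
set t := s / n in t11 t0.
have bt : b ^+ 2 / n * 2025 <= s * t.
  rewrite /t mulrAC mulrA ler_wpM2r ?invr_ge0 ?(ltW n0) //.
  have -> : b ^+ 2 * 2025 = (45 * b) * (45 * b) by ring.
  by rewrite ler_pM // mulr_ge0.
have pl0 : 0 <= p * lambda by rewrite mulr_ge0.
have pl : p * lambda <= eps ^+ 2 * (1 + eps).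
  by rewrite -pD mulrCA ler_wpM2l.
have pN : p * N <= (1 + eps) * (s * t) + p * lambda * s.
  apply: le_trans (ler_wpM2l p0 NE) _; rewrite mulrDr -pD /t.
  by rewrite le_eqVlt; apply/orP; left; apply/eqP; ring.
have pS : p * S <= (1 + eps) * (200 * (b ^+ 2 / n)) + p * lambda * (100 * b).
  apply: le_trans (ler_wpM2l p0 SE) _; rewrite -pD.
  by rewrite le_eqVlt; apply/orP; left; apply/eqP; ring.
have pQ : 2 * (1 + eps) * s <= 2 * (p * Q) + p * N + p * S.
  have := ler_wpM2l p0 QE; rewrite -pD; lra.
have st : 11 * (s * t) <= 12 * eps * s by nra.
have pls : p * lambda * s <= eps ^+ 2 * (1 + eps) * s by rewrite ler_wpM2r.
have plb : p * lambda * (45 * b) <= p * lambda * s by rewrite ler_wpM2l.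
have e2 : eps ^+ 2 * s <= eps / 1000 * s.
  rewrite ler_wpM2r // expr2; nra.
have drift : s * (1 + 38 / 100 * eps) <= p * Q.
  have es0 : 0 <= eps * s by rewrite mulr_ge0 // ltW.
  have h1 : eps ^+ 2 * (1 + eps) * s <= 11 / 1000 / 10 * (eps * s) by nra.
  have h2 : eps * (s * t) <= 1 / 1000 * (s * t).
    by rewrite ler_wpM2r // mulr_ge0.
  have h3 : eps * (b ^+ 2 / n) <= 1 / 1000 * (b ^+ 2 / n).
    by rewrite ler_wpM2r // divr_ge0 ?exprn_ge0 // ltW.
  move: (s * t) (b ^+ 2 / n) (p * lambda * s) bt pN pS pQ st pls plb e2 h1 h2 h3 => u w v.
  lra.
have c0 : 0 <= eps / 10 * (1 - eps / 5) by apply: mulr_ge0; [|move: e1]; clear - e0; lra.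
have := ler_wpM2l c0 drift.
have es0 : 0 <= eps ^+ 2 * s by rewrite mulr_ge0 ?exprn_ge0 // ltW.
have : eps ^+ 3 * s <= 1 / 1000 * (eps ^+ 2 * s).
  by rewrite exprSr mulrAC mulrC ler_wpM2r.
lra.
Qed.

Lemma reach_prob n (G : sgraph n) d (lambda p eps : R) (J : {set 'I_n}) s :
  ndl_graph G d lambda -> lambda <= eps ^+ 2 * d%:R -> p * d%:R = 1 + eps ->
  0 <= p -> p <= 1 -> 0 < eps -> eps <= 1 / 1000 -> (500 <= s)%N ->
  (1000 * #|J| <= s)%N -> 11 * s%:R <= 12 * eps * n%:R ->
  subset_sum p (1 - p) (edges G) (fun A => (#|reach A J| == s)%:R)
    <= 2 * expR (- (eps ^+ 2 * s%:R / 100)).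
Proof.
move=> Gndl lamd pd p0 p1 e0 e1 s500 Js sn.
have lam0 := spectral_radius_ge0 Gndl; have [n1 Greg _] := Gndl.
(* Queue bound: fifty steps of length [B] cover the list of [s] vertices. *)
pose B := (s %/ 50).+1; pose a : R := 1 / 200; pose h := eps / 10.
have sB : (s <= 50 * B)%N.
  by rewrite /B mulnC; apply: ltnW; rewrite ltn_ceil.
have JB : (#|J| <= B)%N by rewrite /B; clear - Js; lia.
have Bs : (45 * B <= s)%N.
  by rewrite /B; clear - s500; have := leq_trunc_div s 50; lia.
have d0 : 0 < d%:R :> R.
  by rewrite lt_neqAle ler0n andbT; apply/negP => /eqP d0; move: pd; rewrite -d0; lra.
have lamd' : lambda < d%:R.
  apply: le_lt_trans lamd _; rewrite gtr_pMl // expr_lt1 ?ltW //; lra.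
have p1' : 0 <= 1 - p by rewrite subr_ge0.
have pointwise (A : {set {set 'I_n}}) : A \subset edges G -> (#|reach A J| == s)%:R <=
    potential p a (explored G B A J) * expR (- (s%:R / 500 / 50)) +
    potential p (- h) (explored G B A J) * expR (- (eps ^+ 2 * s%:R / 100)).
  move=> AE; have [/eqP Rs|_] := boolP (_ == s); last first.
    by rewrite /=; apply: addr_ge0; apply: mulr_ge0; exact: expR_ge0.
  have sB' : (s <= 50 * B)%N by [].
  case: (explored_cases Greg AE JB isT sB' Rs) => [[c [cB cs qd]]|].
    apply: ler_wpDr; first by apply: mulr_ge0; exact: expR_ge0.
    rewrite -expRD -[leLHS]expR0 ler_expR subr_ge0.
    apply: (stuck_exponent pd p0 e0 e1 sB cB cs qd).
  case=> Ds [S [I [Scard Icard QE]]].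
  apply: ler_wpDl; first by apply: mulr_ge0; exact: expR_ge0.
  rewrite -expRD -[leLHS]expR0 ler_expR subr_ge0 Ds.
  have bs : 45 * B%:R <= s%:R :> R by rewrite -natrM ler_nat.
  have n0 : 0 < n%:R :> R by rewrite ltr0n ltnW.
  pose q := #|(explored G B A J).2|.
  have {}QE : 2 * (d%:R * s%:R) <= 2 * q%:R + (inner_degree G S)%:R
      + (\sum_(l < 50) inner_degree G (I l))%N%:R :> R.
    by rewrite -!natrM -!natrD ler_nat.
  have := exhausted_exponent pd p0 e0 e1 n0 (ler0n _ B) bs sn lam0 lamd _ _ QE.
  apply.
    by have := inner_degree_le S Gndl lamd'; rewrite Scard.
  have Ile l : (inner_degree G (I l))%:R <=
      d%:R * (2 * B%:R) ^+ 2 / n%:R + lambda * (2 * B%:R).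
    have c2B : #|I l|%:R <= 2 * B%:R :> R by rewrite -natrM ler_nat.
    apply: le_trans (inner_degree_le _ Gndl lamd') _; rewrite lerD ?ler_wpM2l //.
    by rewrite ler_wpM2r ?invr_ge0 // ler_wpM2l ?(ltW d0) // !expr2 ler_pM.
  rewrite natr_sum; apply: le_trans (ler_sum _ (fun l _ => Ile l)) _.
  by rewrite sumr_const card_ord -[leLHS]mulr_natl.
have a2 : a <= 1 / 2 by rewrite /a; lra.
have h2 : - h <= 1 / 2 by rewrite /h; lra.
apply: le_trans (ler_subset_sum p0 p1' pointwise) _.
rewrite subset_sumD !subset_sumZ mulr2n mulrDl mul1r; apply: lerD.
  apply: le_trans (ler_wpM2r (expR_ge0 _) (potential_explored _ _ _ p0 p1 a2)) _.
  rewrite -expRD ler_expR.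
  have : 1000 * #|J|%:R <= s%:R :> R by rewrite -natrM ler_nat.
  have : eps ^+ 2 * s%:R <= 1 / 1000 * s%:R by rewrite ler_wpM2r // expr2; nra.
  have : 0 <= s%:R :> R by [].
  rewrite /a; lra.
apply: le_trans (ler_wpM2r (expR_ge0 _) (potential_explored _ _ _ p0 p1 h2)) _.
rewrite ler_piMl ?expR_ge0 // -[leRHS]expR0 ler_expR mulNr oppr_le0 mulr_ge0 //.
by rewrite /h; lra.
Qed.
End Prob.

(** * Union bound over sparse cuts *)

Section Boundary.
Variables (n : nat) (G : sgraph n).
Local Notation V := 'I_n.
Implicit Types (S J : {set V}) (F A D : {set {set V}}).

Lemma edge_boundary_incident F S : F \subset edges G ->
  edge_boundary F S \subset incident G S.
Proof.
move=> /subsetP FE; apply/subsetP => e; rewrite !inE => /andP[/FE-> /eqP eS] /=.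
by rewrite -card_gt0 eS.
Qed.

(** Follow a path of [F] from a vertex of [S] to a fixed vertex [x0] of [S].
    Either the path stays in [S], or it first leaves [S] through a boundary
    edge. So [x0] and the ends in [S] of the boundary edges can serve as seeds:
    up to that point the path uses no boundary edge. *)
Lemma boundary_seeds F S (x : V) : F \subset edges G ->
  S \subset component F x -> S != finset.set0 ->
  exists2 J : {set V}, (#|J| <= #|edge_boundary F S|.+1)%N &
    reach (F :\: edge_boundary F S) J = S.
Proof.
move=> /subsetP FE /subsetP SL /set0Pn[x0 x0S].
set D := edge_boundary F S.
have symF : symmetric [rel u v | [set u; v] \in F] by move=> u v /=; rewrite setUC.
pose J := x0 |: \bigcup_(e in D) (e :&: S).
have JS : J \subset S.
  by rewrite subUset sub1set x0S; apply/bigcupsP => e _; rewrite subsetIr.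
exists J.
  rewrite (leq_trans (leq_card_setU _ _)) // cards1 add1n ltnS -[leqRHS]sum1_card.
  elim/big_rec2: _ => [|e m U eD Um]; first by rewrite cards0.
  rewrite (leq_trans (leq_card_setU _ _)) // leq_add //.
  by move: eD; rewrite inE => /andP[_ /eqP->].
apply/eqP; rewrite eqEsubset; apply/andP; split.
  apply: reach_min => // u v uS; rewrite !inE negb_and => /andP[/orP[nF|uvS] uvF].
    by rewrite uvF in nF.
  apply: contraT => vS; move: uvS.
  rewrite setIUl; have -> : [set v] :&: S = finset.set0.
    by apply/eqP; rewrite setI_eq0 disjoints1.
  have -> : [set u] :&: S = [set u] by apply/setIidPl; rewrite sub1set.
  by rewrite setU0 cards1.
apply/subsetP => y yS.
have : connect [rel u v | [set u; v] \in F] y x0.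
  have := SL _ yS; have := SL _ x0S; rewrite !inE => xx0 xy.
  by apply: connect_trans xx0; rewrite (sym_connect_sym symF).
case/connectP => p; elim: p y yS => [|w p IH] y yS /=.
  by move=> _ <-; rewrite mem_reach // !inE eqxx.
case/andP => yw pw x0E; have [wS|wS] := boolP (w \in S); last first.
  apply: mem_reach; rewrite inE; apply/orP; right; apply/bigcupP.
  exists [set y; w]; last by rewrite !inE eqxx yS.
  rewrite inE yw setIUl /=.
  have -> : [set w] :&: S = finset.set0 by apply/eqP; rewrite setI_eq0 disjoints1.
  have -> : [set y] :&: S = [set y] by apply/setIidPl; rewrite sub1set.
  by rewrite setU0 cards1.
have ywG : adj G y w by rewrite -mem_edges FE.
have yNw : y != w by apply: contraTneq ywG => ->; rewrite adj_irrefl.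
apply: (reach_step (u := w)); first exact: IH.
rewrite setUC inE yw andbT inE yw /= (setIidPl _) ?cards2 ?yNw //.
by rewrite subUset !sub1set yS.
Qed.

End Boundary.

Section UnionBound.
Variable R : realType.

(** A union bound over the boundary [D] and the seeds [J]. Closing the edges of
    [D] changes the probability of the configuration by [p / (1 - p)] for each
    of them, and [D] is found among the at most [d * s] edges that meet the
    reached set. Giving weight [z] to each element of [D] and [J] bounds the
    number of choices by a binomial sum, at the price of [z ^- K] and
    [z ^- K.+1]. *)
Lemma low_cut_prob n (G : sgraph n) (p z q : R) d (s K : nat) :
  regular G d -> 0 <= p -> p < 1 -> 0 < z -> z <= 1 -> 0 <= q ->
  (forall J : {set 'I_n}, (#|J| <= K.+1)%N ->
    subset_sum p (1 - p) (edges G) (fun A => (#|reach A J| == s)%:R) <= q) ->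
  subset_sum p (1 - p) (edges G) (fun F =>
    `[< exists x (S : {set 'I_n}), [/\ S \subset component F x, S != finset.set0, #|S| = s
          & (#|edge_boundary F S| <= K)%N] >]%:R)
    <= z ^- (2 * K).+1 * (1 + z) ^+ n * (1 + z * (p / (1 - p))) ^+ (d * s) * q.
Proof.
move=> Greg p0 p1 z0 z1 q0 qP; have p1' : 0 < 1 - p by rewrite subr_gt0.
have t0 : 0 <= p / (1 - p) by rewrite divr_ge0 // ltW.
have zV k : 0 <= z ^- k by rewrite invr_ge0 exprn_ge0 // ltW.
have zt0 : 0 <= z * (p / (1 - p)) by rewrite mulr_ge0 // ltW.
have w0 k : 0 <= (1 + z * (p / (1 - p))) ^+ k by rewrite exprn_ge0 // addr_ge0.
pose f (J : {set 'I_n}) (A D : {set {set 'I_n}}) : R :=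
  ((#|D| <= K) && (D \subset incident G (reach A J)) && (#|reach A J| == s))%N%:R.
have zk m k : (m <= k)%N -> 1 <= z ^- k * z ^+ m.
  move=> mk; rewrite mulrC ler_pdivlMr ?exprn_gt0 // mul1r.
  by apply: ler_wiXn2l => //; exact: ltW.
have step1 : subset_sum p (1 - p) (edges G) (fun F =>
    `[< exists x (S : {set 'I_n}), [/\ S \subset component F x, S != finset.set0, #|S| = s
          & (#|edge_boundary F S| <= K)%N] >]%:R) <=
  \sum_(J : {set 'I_n} | (#|J| <= K.+1)%N)
    subset_sum p (1 - p) (edges G) (fun F => \sum_(D in powerset F) f J (F :\: D) D).
  rewrite -subset_sum_exchange; apply: ler_subset_sum => // [|F FE]; first exact: ltW.
  case: asboolP => [|_]; last by rewrite sumr_ge0 // => J _; rewrite sumr_ge0.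
  case=> x [S [SL S0 Ss SK]].
  have [J JD JS] := boundary_seeds FE SL S0.
  rewrite (bigD1 J) ?(leq_trans JD) //= ler_wpDr ?sumr_ge0 // => [J' _|].
    by rewrite sumr_ge0.
  rewrite (bigD1 (edge_boundary F S)) /=; last first.
    by rewrite powersetE; apply/subsetP => e; rewrite inE => /andP[].
  rewrite ler_wpDr ?sumr_ge0 // /f JS SK Ss eqxx andbT.
  by rewrite edge_boundary_incident.
apply: le_trans step1 _.
have step2 (J : {set 'I_n}) : (#|J| <= K.+1)%N ->
  subset_sum p (1 - p) (edges G) (fun F => \sum_(D in powerset F) f J (F :\: D) D)
  <= q * (z ^- K * (1 + z * (p / (1 - p))) ^+ (d * s)).
  move=> JK; rewrite subset_sum_erase ?gt_eqF //.
  apply: le_trans (ler_wpM2r _ (qP J JK)); last first.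
    exact: mulr_ge0.
  rewrite -subset_sumZ; apply: ler_subset_sum => // [|A AE]; first exact: ltW.
  rewrite /f; have [/eqP As|_] := boolP (_ == s); last first.
    by rewrite mul0r big1 // => D _; rewrite andbF mulr0.
  rewrite mul1r.
  have -> : z ^- K * (1 + z * (p / (1 - p))) ^+ (d * s) =
    z ^- K * (1 + z * (p / (1 - p))) ^+ (d * s - #|incident G (reach A J)|)
     * (1 + z * (p / (1 - p))) ^+ #|incident G (reach A J)|.
    by rewrite -mulrA -exprD subnK // -As card_incident.
  set t := p / (1 - p) in t0 zt0 w0 *; set X := incident G _.
  have -> : (1 + z * t) ^+ #|X| = \sum_(D in powerset X) (z * t) ^+ #|D|.
    rewrite addrC -subset_sum1; apply: eq_bigr => D _.
    by rewrite expr1n !mulr1.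
  apply: (@le_trans _ _ (z ^- K * \sum_(D in powerset X) (z * t) ^+ #|D|)); last first.
    rewrite ler_wpM2r ?sumr_ge0 // => [D _|]; first exact: exprn_ge0.
    rewrite ler_peMr //.
    by rewrite exprn_ege1 // lerDl.
  rewrite mulr_sumr big_mkcond [leRHS]big_mkcond; apply: ler_sum => D _.
  rewrite !powersetE andbT; case: (D \subset X); last first.
    by rewrite andbF mulr0; case: ifP.
  rewrite andbT; case: ifP => _; last by rewrite mulr_ge0 ?exprn_ge0.
  have [DK|_] := leqP; last by rewrite mulr0 mulr_ge0 ?exprn_ge0.
  by rewrite /= ?mulr1 (exprMn #|D| z t) mulrA ler_peMl ?exprn_ge0 ?zk.
apply: le_trans (ler_sum _ (fun J JK => step2 J JK)) _.
set c := q * _; have c0 : 0 <= c.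
  by rewrite mulr_ge0 // mulr_ge0.
have -> : z ^- (2 * K).+1 * (1 + z) ^+ n * (1 + z * (p / (1 - p))) ^+ (d * s) * q =
    (z ^- K.+1 * (1 + z) ^+ n) * c.
  have -> : (2 * K).+1 = (K + K.+1)%N by lia.
  by rewrite /c exprD invfM; ring.
have -> : (1 + z) ^+ n = \sum_(J in powerset [set: 'I_n]) z ^+ #|J|.
  rewrite addrC -[n in LHS]card_ord -cardsT -subset_sum1; apply: eq_bigr => D _.
  by rewrite expr1n !mulr1.
rewrite mulr_sumr mulr_suml big_mkcond [leRHS]big_mkcond; apply: ler_sum => J _.
rewrite powersetE subsetT; case: leqP => JK.
  by rewrite ler_peMl // zk.
by rewrite mulr_ge0 // mulr_ge0 ?exprn_ge0 // ltW.
Qed.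

End UnionBound.

(** * Choice of the constants *)

Section Numerics.
Variable R : realType.
Implicit Types (eps : R).

Lemma ln_inv_ge1 eps : 0 < eps -> eps <= 1 / 4 -> 1 <= ln (1 / eps).
Proof.
move=> e0 e4; rewrite -[leLHS]expRK ler_ln ?posrE ?expR_gt0 ?divr_gt0 //.
apply: (@le_trans _ _ 4); last by rewrite ler_pdivlMr //; lra.
have h : expR (1 / 2) <= 2 :> R.
  by apply: le_trans (expR_le_quadratic (lexx _)) _; lra.
have -> : 1 = 2%:R * (1 / 2) :> R by lra.
rewrite expRM_natl expr2; have := expR_ge0 (1 / 2 : R); nra.
Qed.

(** With [z = eps ^+ 5] the power [z ^- (2 * K)] equals
    [expR (10 * K * ln (1 / eps))], and the bound on [K] makes it at most
    [expR (eps ^+ 2 * s / 400)]. The other two factors have exponents of order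
    [eps ^+ 3 * s]. *)
Lemma union_factor_le (eps t : R) (n d s K : nat) :
  0 < eps -> eps <= 1 / 200 / 100 -> 0 <= t -> t * d%:R <= 4 ->
  eps ^+ 2 * n%:R <= 50 * s%:R ->
  K%:R * ln (1 / eps) <= eps ^+ 2 * s%:R / 400 / 10 ->
  (eps ^+ 5) ^- (2 * K).+1 * (1 + eps ^+ 5) ^+ n * (1 + eps ^+ 5 * t) ^+ (d * s)
     * (2 * expR (- (eps ^+ 2 * s%:R / 100)))
  <= 2 * eps ^- 5 * expR (- (eps ^+ 2 * s%:R / 400)).
Proof.
move=> e0 e1 t0 td nS Kl; set l := ln (1 / eps) in Kl.
have epsE : eps = expR (- l).
  by rewrite expRN lnK ?posrE ?divr_gt0 // div1r invrK.
have z0 : 0 < eps ^+ 5 by rewrite exprn_gt0.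
have A1 : (eps ^+ 5) ^- (2 * K).+1 = eps ^- 5 * expR (10 * (K%:R * l)).
  rewrite exprSr invfM mulrC; congr (_ * _).
  rewrite -exprM [in LHS]epsE -expRM_natl -expRN; congr expR.
  by rewrite !natrM; ring.
have exp_pow x m : 0 <= x -> (1 + x) ^+ m <= expR (m%:R * x) :> R.
  move=> x0; rewrite expRM_natl; apply: lerXn2r; rewrite ?nnegrE ?addr_ge0 ?expR_ge0 //.
  exact: expR_ge1Dx.
have A2 := exp_pow (eps ^+ 5) n (ltW z0).
have zt0 : 0 <= eps ^+ 5 * t by rewrite mulr_ge0 // ltW.
have A3 := exp_pow (eps ^+ 5 * t) (d * s)%N zt0.
have P0 : 0 <= (1 + eps ^+ 5) ^+ n by rewrite exprn_ge0 // addr_ge0 // ltW.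
have Q0 : 0 <= (1 + eps ^+ 5 * t) ^+ (d * s) by rewrite exprn_ge0 // addr_ge0.
rewrite A1; move: A2 A3 P0 Q0.
move: ((1 + eps ^+ 5) ^+ n) ((1 + eps ^+ 5 * t) ^+ (d * s)) => P Q A2 A3 P0 Q0.
have -> x y : eps ^- 5 * x * P * Q * (2 * y) = 2 * eps ^- 5 * (x * (P * (Q * y))) by ring.
rewrite ler_pM2l ?mulr_gt0 ?invr_gt0 ?exprn_gt0 //.
apply: (@le_trans _ _ (expR (10 * (K%:R * l)) * (expR (n%:R * eps ^+ 5) *
    (expR ((d * s)%:R * (eps ^+ 5 * t)) * expR (- (eps ^+ 2 * s%:R / 100)))))).
  rewrite ler_wpM2l ?expR_ge0 // ler_pM ?mulr_ge0 ?expR_ge0 //.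
  by rewrite ler_wpM2r ?expR_ge0.
rewrite -!expRD ler_expR natrM.
have s0 : 0 <= s%:R :> R by [].
have x0 : 0 <= eps ^+ 2 * s%:R by rewrite mulr_ge0 // exprn_ge0 // ltW.
have B1 : eps ^+ 3 * s%:R <= 1 / 200 / 100 * (eps ^+ 2 * s%:R).
  by rewrite exprSr mulrAC mulrC ler_wpM2r.
have e31 : eps ^+ 3 <= 1 by rewrite exprn_ile1 ?(ltW e0) //; lra.
have B2 : n%:R * eps ^+ 5 <= 50 * (eps ^+ 3 * s%:R).
  have -> : n%:R * eps ^+ 5 = eps ^+ 3 * (eps ^+ 2 * n%:R) by ring.
  have -> : 50 * (eps ^+ 3 * s%:R) = eps ^+ 3 * (50 * s%:R) by ring.
  by rewrite ler_wpM2l // exprn_ge0 // ltW.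
have B3 : d%:R * s%:R * (eps ^+ 5 * t) <= 4 * (eps ^+ 3 * s%:R).
  have -> : d%:R * s%:R * (eps ^+ 5 * t) = (t * d%:R) * (eps ^+ 5 * s%:R) by ring.
  apply: ler_pM => //; [by rewrite mulr_ge0|by rewrite mulr_ge0 // ltW|].
  rewrite ler_wpM2r // (exprD _ 3 2) ler_piMr ?exprn_ge0 ?(ltW e0) //.
  by rewrite exprn_ile1 ?(ltW e0) //; lra.
move: (eps ^+ 2 * s%:R) (eps ^+ 3 * s%:R) (K%:R * l) (n%:R * eps ^+ 5) (d%:R * s%:R * _)
  x0 Kl B1 B2 B3 => *; lra.
Qed.

End Numerics.

Section Main.
Variable R : realType.

Definition expands n (eps c : R) (F : {set {set 'I_n}}) : Prop :=
  forall L : {set 'I_n}, largest_component F L ->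
  forall S : {set 'I_n}, S \subset L ->
    eps ^+ 2 * n%:R / 50 <= #|S|%:R ->
    #|S|%:R <= 12 * eps * n%:R / 11 ->
    c * eps ^+ 2 * #|S|%:R / ln (1 / eps) <= #|edge_boundary F S|%:R.

Lemma expands_prob n (G : sgraph n) d (lambda eps : R) :
  ndl_graph G d lambda -> (0 < d)%N -> 0 < eps -> eps <= 1 / 200 / 100 ->
  lambda <= eps ^+ 4 * d%:R -> 2 <= eps ^+ 4 * n%:R ->
  1 - n.+1%:R * (2 * eps ^- 5 * expR (- (eps ^+ 4 * n%:R / 200 / 100)))
   <= percolation_pr G ((1 + eps) / d%:R) (expands eps (1 / 400 / 10)) <= 1.
Proof.
move=> Gndl d0 e0 e1 lamd n_big.
have [n1 Greg _] := Gndl; set p := (1 + eps) / d%:R; set l := ln (1 / eps).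
have dR : 0 < d%:R :> R by rewrite ltr0n.
have nR : 0 < n%:R :> R by rewrite ltr0n ltnW.
have pd : p * d%:R = 1 + eps by rewrite /p divfK // gt_eqF.
have l1 : 1 <= l by apply: ln_inv_ge1 => //; lra.
have e_1 : eps <= 1 by lra.
have e2_1 : eps ^+ 2 <= 1 by rewrite exprn_ile1 ?(ltW e0) //; lra.
have e4_2 : eps ^+ 4 <= eps ^+ 2.
  by rewrite (exprD _ 2 2) ler_piMr // exprn_ge0 // ltW.
have e4_1 : eps ^+ 4 < 1 by rewrite exprn_ilt1 ?(ltW e0) //; lra.
have lam2 : lambda <= eps ^+ 2 * d%:R.
  by apply: le_trans lamd _; rewrite ler_wpM2r // ltW.
have p0 : 0 <= p by rewrite divr_ge0 ?(ltW dR) //; lra.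
have d_big : 1 <= 2 * eps ^+ 4 * d%:R.
  have lam_lt : lambda < d%:R by apply: le_lt_trans lamd _; rewrite gtr_pMl.
  have := degree_lower_bound Gndl d0 lam_lt.
  have : 2 / n%:R <= eps ^+ 4 by rewrite ler_pdivrMr.
  move=> /(ler_wpM2l (ltW dR)); lra.
have e4s : eps ^+ 4 <= 1 / 200 / 100.
  apply: le_trans (e1); rewrite exprS ler_piMr ?(ltW e0) // exprn_ile1 ?(ltW e0) //.
have p_half : p <= 1 / 2.
  rewrite /p ler_pdivrMr //; have := ler_wpM2r (ltW dR) e4s; lra.
have p1 : p < 1 by lra.
have p1' : 0 <= 1 - p by lra.
pose t := p / (1 - p).
have t0 : 0 <= t by rewrite divr_ge0.
have td : t * d%:R <= 4.
  rewrite /t mulrAC pd ler_pdivrMr; lra.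
(* The largest number of boundary edges that does not exceed the claimed bound. *)
pose K (s : nat) := Num.trunc (1 / 400 / 10 * eps ^+ 2 * s%:R / l).
have K_ge (s : nat) : 0 <= 1 / 400 / 10 * eps ^+ 2 * s%:R / l.
  by rewrite divr_ge0 ?mulr_ge0 ?exprn_ge0 ?(ltW e0) //; lra.
have Kl (s : nat) : (K s)%:R * l <= eps ^+ 2 * s%:R / 400 / 10.
  have l0 : 0 < l by lra.
  rewrite -ler_pdivlMr //; have := K_ge s; rewrite -truncn_le -/(K s).
  by move=> /le_trans; apply; rewrite le_eqVlt; apply/orP; left; apply/eqP; ring.
pose in_range (s : nat) := (eps ^+ 2 * n%:R <= 50 * s%:R :> R) && (11 * s%:R <= 12 * eps * n%:R :> R).
pose low_cut (s : nat) (F : {set {set 'I_n}}) : Prop :=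
  exists x (S : {set 'I_n}), [/\ S \subset component F x, S != finset.set0, #|S| = s
          & (#|edge_boundary F S| <= K s)%N].
have low_cut_le (s : nat) : in_range s ->
  subset_sum p (1 - p) (edges G) (fun F => `[< low_cut s F >]%:R)
  <= 2 * eps ^- 5 * expR (- (eps ^+ 4 * n%:R / 200 / 100)).
  case/andP=> s_lo s_hi.
  have s_big : 4000 <= s%:R :> R.
    have s0 : 0 <= s%:R :> R by [].
    have : eps ^+ 2 * (eps ^+ 2 * n%:R) <= eps ^+ 2 * (50 * s%:R).
      by rewrite ler_wpM2l // exprn_ge0 // ltW.
    have -> : eps ^+ 2 * (eps ^+ 2 * n%:R) = eps ^+ 4 * n%:R by ring.
    have : eps ^+ 2 * (50 * s%:R) <= 1 / 200 / 100 * (1 / 200) * (50 * s%:R).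
      rewrite ler_wpM2r ?mulr_ge0 // expr2; apply: ler_pM => //; rewrite ?(ltW e0) //; lra.
    lra.
  apply: le_trans (low_cut_prob (z := eps ^+ 5) (q := 2 * expR (- (eps ^+ 2 * s%:R / 100))) Greg p0 p1 _ _ _ _) _.
  - by rewrite exprn_gt0.
  - by rewrite exprn_ile1 ?(ltW e0) //; lra.
  - by rewrite mulr_ge0 // expR_ge0.
  - move=> J JK; apply: (reach_prob Gndl lam2 pd) => //; [lra|lra| | ].
    + by rewrite -(ler_nat R); lra.
    + rewrite -(ler_nat R) natrM.
      have JK' : #|J|%:R <= (K s)%:R + 1 :> R by rewrite natr1 ler_nat.
      have : (K s)%:R <= (K s)%:R * l by rewrite ler_peMr.
      have := Kl s; have : eps ^+ 2 * s%:R <= s%:R by rewrite ler_piMl.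
      lra.
  apply: le_trans (union_factor_le e0 e1 t0 td s_lo (Kl s)) _.
  rewrite ler_wpM2l ?mulr_ge0 ?invr_ge0 ?exprn_ge0 ?(ltW e0) // ler_expR lerN2.
  have -> : eps ^+ 4 * n%:R = eps ^+ 2 * (eps ^+ 2 * n%:R) by ring.
  have : eps ^+ 2 * (eps ^+ 2 * n%:R) <= eps ^+ 2 * (50 * s%:R).
    by rewrite ler_wpM2l // exprn_ge0 // ltW.
  lra.
have total : subset_sum p (1 - p) (edges G) (fun=> 1) = 1.
  by rewrite subset_sum1 subrKC expr1n.
rewrite percolation_prE; apply/andP; split; last first.
  by rewrite -[leRHS]total; apply: ler_subset_sum => // F _; case: asbool.
rewrite lerBlDr -[leLHS]total.
apply: (@le_trans _ _ (subset_sum p (1 - p) (edges G) (fun F =>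
    (`[< expands eps (1 / 400 / 10) F >])%:R +
     \sum_(s < n.+1 | in_range s) `[< low_cut s F >]%:R))).
  apply: ler_subset_sum => // F _; case: asboolP => [_|notexp].
    by rewrite lerDl sumr_ge0.
  rewrite add0r; have [L [L_large [S [SL S_lo S_hi cut]]]] : exists L, largest_component F L /\
    exists S : {set 'I_n}, [/\ S \subset L, eps ^+ 2 * n%:R / 50 <= #|S|%:R,
      #|S|%:R <= 12 * eps * n%:R / 11 &
      #|edge_boundary F S|%:R < 1 / 400 / 10 * eps ^+ 2 * #|S|%:R / l].
    apply: contrapT => none; apply: notexp => L LF S SL lo hi; rewrite leNgt.
    by apply/negP => cut; apply: none; exists L; split => //; exists S.
  have Sn : (#|S| < n.+1)%N by rewrite ltnS -[leqRHS](card_ord n) max_card.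
  have S_range : in_range (Ordinal Sn).
    by rewrite /in_range /=; apply/andP; split; lra.
  rewrite (bigD1 (Ordinal Sn)) //= ler_wpDr ?sumr_ge0 //.
  case: asboolP => // -[]; case: L_large => -[x Lx] _; exists x, S; split => //.
  - by rewrite -Lx.
  - rewrite -card_gt0 -(ltr0n R); apply: lt_le_trans S_lo.
    by rewrite divr_gt0 // mulr_gt0 // exprn_gt0.
  - by rewrite /K truncn_ge_nat //; apply: ltW.
rewrite subset_sumD lerD2l subset_sum_exchange.
apply: le_trans (ler_sum _ (fun (s : 'I_n.+1) (sP : in_range s) => low_cut_le s sP)) _.
rewrite -[n.+1 in leRHS]card_ord -sum1_card natr_sum mulr_suml.
rewrite big_mkcond; apply: ler_sum => s _; rewrite mul1r; case: ifP => // _.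
by rewrite mulr_ge0 ?expR_ge0 // mulr_ge0 // invr_ge0 exprn_ge0 // ltW.
Qed.

End Main.

(** The square of [1 + b * m / 2 <= expR (b * m / 2)] makes the exponential grow
    quadratically, which beats the linear factor. *)
Lemma linear_expR_le (R : realType) (C b : R) (m : nat) :
  0 <= C -> 0 < b -> (0 < m)%N ->
  m.+1%:R * (C * expR (- (b * m%:R))) <= 8 * C / b ^+ 2 / m%:R.
Proof.
move=> C0 b0 m0; have mR : 0 < m%:R :> R by rewrite ltr0n.
set y := b * m%:R / 2; have y0 : 0 < y by rewrite divr_gt0 // mulr_gt0.
have y2 : y ^+ 2 <= expR (b * m%:R).
  have -> : b * m%:R = 2%:R * y by rewrite /y; field.
  rewrite expRM_natl; apply: lerXn2r; rewrite ?nnegrE ?expR_ge0 ?(ltW y0) //.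
  by apply: le_trans (expR_ge1Dx _); rewrite lerDr.
have : expR (- (b * m%:R)) <= (y ^+ 2)^-1.
  by rewrite expRN lef_pV2 ?posrE ?expR_gt0 ?exprn_gt0.
have m1 : m.+1%:R <= 2 * m%:R :> R by rewrite -natrM ler_nat; lia.
have -> : 8 * C / b ^+ 2 / m%:R = (2 * m%:R) * (C * (y ^+ 2)^-1).
  by rewrite /y; field; rewrite !gt_eqF.
by move=> h; apply: ler_pM => //; rewrite ?mulr_ge0 ?expR_ge0 ?ler_wpM2l.
Qed.

Local Open Scope classical_set_scope.

Theorem theorem2 (R : realType) :
  exists eps0 c : R, [/\ 0 < eps0, 0 < c &
    forall eps delta : R,
      0 < eps -> eps <= eps0 -> 0 < delta -> delta <= eps ^+ 4 ->
    forall (n d : nat -> nat) (lambda : nat -> R) (G : forall k, sgraph (n k)),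
      n @ \oo --> \oo ->
      (forall k, (0 < d k)%N) ->
      (forall k, ndl_graph (G k) (d k) (lambda k)) ->
      (forall k, lambda k / (d k)%:R <= delta) ->
    percolation_pr (G k) ((1 + eps) / (d k)%:R)
      (fun F => forall L : {set 'I_(n k)}, largest_component F L ->
         forall S : {set 'I_(n k)}, S \subset L ->
           eps ^+ 2 * (n k)%:R / 50 <= #|S|%:R ->
           #|S|%:R <= 12 * eps * (n k)%:R / 11 ->
           c * eps ^+ 2 * #|S|%:R / ln (1 / eps)
             <= #|edge_boundary F S|%:R)
      @[k --> \oo] --> (1 : R)].
Proof.
exists (1 / 200 / 100), (1 / 400 / 10); split; [lra|lra|].
move=> eps delta e0 e1 _ de n d lambda G n_oo d0 Gndl lamd.
pose b := eps ^+ 4 / 200 / 100; pose C := 2 * eps ^- 5.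
have b0 : 0 < b by rewrite !divr_gt0 // exprn_gt0.
have C0 : 0 <= C by rewrite mulr_ge0 // invr_ge0 exprn_ge0 // ltW.
apply/cvgrPdist_le => e epos.
(* The second entry gives the size required by the finite bound, the third one
   makes the error term at most [e]. *)
pose N := maxn 1 (maxn (Num.trunc (2 / eps ^+ 4)).+1 (Num.trunc (8 * C / b ^+ 2 / e)).+1).
have n_large : \forall k \near \oo, (N <= n k)%N by move/cvgnyPge: n_oo; apply.
near=> k.
have : (N <= n k)%N by near: k.
rewrite !geq_max => /and3P[n1 n2 n3].
have nR : 0 < (n k)%:R :> R by rewrite ltr0n.
have e4 : 0 < eps ^+ 4 by rewrite exprn_gt0.
have n_big : 2 <= eps ^+ 4 * (n k)%:R.
  rewrite -ler_pdivrMl // mulrC ltW //; apply: lt_le_trans (truncnS_gt _) _.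
  by rewrite ler_nat.
have lam : lambda k <= eps ^+ 4 * (d k)%:R.
  by rewrite -ler_pdivrMr ?ltr0n // (le_trans (lamd k)).
have /andP[lo hi] := expands_prob (Gndl k) (d0 k) e0 e1 lam n_big.
rewrite ger0_norm ?subr_ge0 // lerBlDr addrC -lerBlDr; apply: le_trans lo.
rewrite lerD2l lerN2.
have -> : eps ^+ 4 * (n k)%:R / 200 / 100 = b * (n k)%:R by rewrite /b; ring.
apply: le_trans (linear_expR_le C0 b0 n1) _.
rewrite ler_pdivrMr // [e * _]mulrC -ler_pdivrMr // ltW //.
by apply: lt_le_trans (truncnS_gt _) _; rewrite ler_nat.
Unshelve. all: by end_near.
Qed.
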